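(* Let $\mathcal{G}$ be a finite Abelian group, $\mathcal{G}\cong\mathbb{Z}_{p_1^{m_1}}\times\cdots\times\mathbb{Z}_{p_n^{m_n}}$ with $p_i$ primes, and let $\mathcal{L}=\mathrm{lcm}\{p_1^{m_1},\ldots,p_n^{m_n}\}$ be a constant. Let $\epsilon,\tau\in(0,1/2]$. Given a known set $A\subset\mathcal{G}$ with $\|\widehat{\mathbb{1}_A}\|_1\le s$ and membership query access to an unknown set $B\subset\mathcal{G}$, the query complexity of deciding whether $\mathrm{dist}_{\mathcal{G}}(A,B)\le\epsilon$ or $\mathrm{dist}_{\mathcal{G}}(A,B)\ge\epsilon+\tau$ is $\tilde O\!\left(\frac{s^8}{\tau^8}\right)$, where $\tilde O(\cdot)$ hides multiplicative factors in $\log s$ and $\log(1/\tau)$ up to constants.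
   Context: For $A\subseteq\mathcal{G}$, $\mathbb{1}_A:\mathcal{G}\to\{-1,1\}$ is $-1$ on $A$ and $1$ off $A$. For $r\in\mathcal{G}$, $\chi_r(x)=\prod_i\omega_{p_i^{m_i}}^{r^{(i)}x^{(i)}}$ ($\omega_q$ a primitive $q$-th root of unity); $\widehat h(\chi)=\frac{1}{|\mathcal{G}|}\sum_x h(x)\overline{\chi(x)}$; $\|\widehat h\|_1=\sum_{r\in\mathcal{G}}|\widehat h(\chi_r)|$. For $A,B\subseteq\mathcal{G}$, $\mathrm{dist}(A,B)=\frac{|A\setminus B|+|B\setminus A|}{|\mathcal{G}|}$ and $\mathrm{dist}_{\mathcal{G}}(A,B)=\min_{\sigma\in\mathrm{Aut}(\mathcal{G})}\mathrm{dist}(A,\sigma(B))$. A membership query asks whether a chosen $x\in\mathcal{G}$ lies in $B$. Deciding means a randomized algorithm correct with probability at least $2/3$ under the promise that one of the two cases holds. *)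

(* Defs.v *)
From HB Require Import structures.
From mathcomp Require Import all_boot all_order all_algebra all_fingroup.
From mathcomp Require Import all_classical all_reals all_analysis.
From mathcomp.real_closed Require Import complex.

Set Implicit Arguments.
Unset Strict Implicit.
Unset Printing Implicit Defensive.

Import Order.TTheory GRing.Theory Num.Theory.
Local Open Scope ring_scope.

(* Z_(p_1^m_1) x ... x Z_(p_n^m_n), with the additive group law on each factor.
   'Z_q is Z/q only for 1 < q, so this has its intended meaning when every p i
   is prime and every m i is positive. *)
Notation prod_cyclic p m := {dffun forall i, 'Z_(p i ^ m i)}.

Section Fourier.
Variables (R : realType) (n : nat) (p m : 'I_n -> nat) (gT : finGroupType).
Variables (phi : gT -> prod_cyclic p m) (omega : nat -> R[i]).

(* omega q stands for the chosen primitive q-th root of unity, and the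
   coordinate r^(i) of r is phi r i, read as its representative in
   {0, ..., p_i^m_i - 1}. *)
Definition chi (r x : gT) : R[i] :=
  \prod_(i < n) omega (p i ^ m i)%N ^+ ((phi r i : nat) * (phi x i : nat))%N.

Definition fourier (h c : gT -> R[i]) : R[i] :=
  (#|gT|%:R)^-1 * \sum_(x : gT) h x * Num.conj (c x).

Definition fourier_norm1 (h : gT -> R[i]) : R :=
  \sum_(r : gT) ComplexField.Normc.normc (fourier h (chi r)).

End Fourier.

Definition sign_ind (R : realType) (gT : finGroupType) (A : {set gT}) (x : gT)
    : R[i] :=
  if x \in A then -1 else 1.

Section Distance.
Variables (R : realType) (gT : finGroupType).
Implicit Types A B : {set gT}.

Definition dist A B : R := (#|A :\: B| + #|B :\: A|)%:R / #|gT|%:R.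

(* The default value dist A B of the iterated minimum is attained at the
   identity automorphism, so it does not affect the minimum. *)
Definition dist_Aut A B : R :=
  \big[Num.min/dist A B]_(sigma in Aut [set: gT]) dist A (sigma @: B).

End Distance.

(* Deterministic adaptive algorithms with membership queries to a subset of T:
   [Query x t1 t0] asks whether x is in the set, and continues with t1 on a
   positive answer and with t0 on a negative one. *)
Inductive query_tree (T : Type) : Type :=
  | Answer of bool
  | Query of T & query_tree T & query_tree T.

Fixpoint run_tree (T : finType) (t : query_tree T) (B : {set T}) : bool :=
  match t with
  | Answer b => b
  | Query x t1 t0 => if x \in B then run_tree t1 B else run_tree t0 B
  end.

Fixpoint num_queries (T : Type) (t : query_tree T) : nat :=
  match t with
  | Answer _ => 0
  | Query _ t1 t0 => (maxn (num_queries t1) (num_queries t0)).+1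
  end.

(* A randomized algorithm is a probability distribution on deterministic ones.
   Over a finite T there are finitely many trees of a given depth, so finitely
   supported distributions lose no generality. *)
Record rand_alg (R : realType) (T : finType) : Type := RandAlg {
  seed : finType;
  seed_prob : seed -> R;
  seed_tree : seed -> query_tree T;
  seed_prob_ge0 : forall w, 0 <= seed_prob w;
  seed_prob_sum1 : \sum_(w : seed) seed_prob w = 1
}.

Definition prob_output (R : realType) (T : finType) (M : rand_alg R T)
    (B : {set T}) (b : bool) : R :=
  \sum_(w : seed M | run_tree (seed_tree w) B == b) seed_prob w.

Definition query_bounded (R : realType) (T : finType) (M : rand_alg R T)
    (q : nat) : Prop :=
  forall w : seed M, (num_queries (seed_tree w) <= q)%N.

Section Isomorphism.
Variables (R : realType) (gT : finGroupType).

(* Output [true] stands for "dist_Aut A B <= eps" and [false] for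
   "eps + tau <= dist_Aut A B". *)
Definition decides_iso (A : {set gT}) (eps tau : R) (M : rand_alg R gT)
    : Prop :=
  forall B : {set gT},
    (dist_Aut R A B <= eps -> 2 / 3 <= prob_output M B true) /\
    (eps + tau <= dist_Aut R A B -> 2 / 3 <= prob_output M B false).

Definition solvable_with (A : {set gT}) (eps tau : R) (q : nat) : Prop :=
  exists M : rand_alg R gT, query_bounded M q /\ decides_iso A eps tau M.

Definition is_query_complexity (A : {set gT}) (eps tau : R) (q : nat) : Prop :=
  solvable_with A eps tau q /\
  (forall q' : nat, solvable_with A eps tau q' -> (q <= q')%N).

End Isomorphism.

(* Main.v *)
Require Import Defs.
From HB Require Import structures.
From mathcomp Require Import all_boot all_order all_algebra all_fingroup.
From mathcomp Require Import all_solvable.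
From mathcomp Require Import all_classical all_reals all_analysis.
From mathcomp.real_closed Require Import complex.
From mathcomp Require Import ring lra zify.

(* Let g be the +-1 indicator of the unknown set B.  Since the spectral norm of
   1_A is at most s, the distance of A to an automorphic image of B is
   determined up to tau by the Fourier coefficients of g up to an additive
   error gamma ~ tau / s, taken up to automorphism; only the O(gamma^-4) large
   ones matter.  Let X be the subgroup generated by M = O(gamma^-4) random
   points of each torsion subgroup G[d].  With high probability:
   - a product of large characters that is nontrivial on some G[d] is
     nontrivial at a sampled point of G[d];
   - the classes of characters agreeing on X have small L2 mass outside the
     large coefficients (a pairwise collision count);
   - the autocorrelations g(c) g(cy) at O(gamma^-8) random pairs (c in G,
     y in X) estimate the L2 mass of every class within gamma^2 (Hoeffding and
     a union bound over the characters of X);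
   - the sampled points of G = G[0] estimate each heavy coefficient of g within
     gamma (Chebyshev).
   If two sets give the same answers at a sample that is good for both, their
   heavy characters are therefore matched by restriction to X, and matched
   characters satisfy the same relations on every G[d].  Counting homomorphisms
   by their kernels then yields an automorphism that realizes the matching.  So
   accepting when some yes-instance, for which the sample is good, explains the
   answers is correct. *)

Set Implicit Arguments.
Unset Strict Implicit.
Unset Printing Implicit Defensive.

Import Order.TTheory GRing.Theory Num.Theory.
Local Open Scope ring_scope.

Lemma sum_expr_root1 (F : fieldType) (L : nat) (z : F) :
  z ^+ L = 1 -> \sum_(c < L) z ^+ c = if z == 1 then L%:R else 0.
Proof.
move=> zL; case: eqP => [->|/eqP z1].
  by under eq_bigr do rewrite expr1n; rewrite sumr_const card_ord.
have := subrX1 z L; rewrite zL subrr => /esym/eqP.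
by rewrite mulf_eq0 subr_eq0 (negPf z1) => /eqP.
Qed.

(** * Lifting relations between characters to automorphisms *)

Section TorsionSum.
Variables (gT : finGroupType) (F : fieldType) (d : nat) (u : gT -> F).
Hypothesis cG : abelian [set: gT].
Hypothesis uM : forall x y, u (x * y)%g = u x * u y.

Lemma torsion_mul (x y : gT) :
  (y ^+ d = 1)%g -> ((x * y) ^+ d == 1)%g = (x ^+ d == 1)%g.
Proof.
move=> yd; rewrite expgMn ?yd ?mulg1 //.
by apply: (centsP cG); rewrite inE.
Qed.

(** Translation by a torsion point [y] multiplies the sum by [u y], so the sum vanishes as soon as
    [u] is nontrivial on the [d]-torsion. *)
Lemma sum_torsion_hom :
  u 1%g = 1 ->
  \sum_(x : gT | (x ^+ d == 1)%g) u x =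
    if [forall x : gT, (x ^+ d == 1)%g ==> (u x == 1)]
    then #|[set x : gT | (x ^+ d == 1)%g]|%:R else 0.
Proof.
move=> u1; case: ifPn => [/forallP tr|].
  rewrite cardsE -sumr_const; apply: eq_bigr => x xd.
  by apply/eqP; apply: (implyP (tr x)).
case/forallPn => y; rewrite negb_imply => /andP[/eqP yd uy1].
set s := \sum_(x | _) _.
suff: s = s * u y.
  move/eqP; rewrite -subr_eq0 -{1}[s]mulr1 -mulrBr mulf_eq0 subr_eq0.
  by rewrite [1 == _]eq_sym (negPf uy1) orbF => /eqP.
rewrite {1}/s (reindex_inj (mulIg y)) /= mulr_suml.
by apply: eq_big => [x|x _]; rewrite ?torsion_mul ?uM.
Qed.
End TorsionSum.

(** * Counting homomorphisms with prescribed character values *)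

Section HomCount.
Variables (gT : finGroupType) (F : fieldType) (I : finType).
Hypothesis cG : abelian [set: gT].

(** The value 1 outside [D] makes each homomorphism on [D] exactly one finite function, so that
    cardinals count homomorphisms. *)
Definition homs_over (a : I -> gT -> F) (rT : finGroupType) (D : {set rT})
    (k : I -> rT -> F) : {set {ffun rT -> gT}} :=
  [set f : {ffun rT -> gT} |
    [&& [forall x in D, forall y in D, f (x * y)%g == (f x * f y)%g],
        [forall x, (x \notin D) ==> (f x == 1%g)]
      & [forall i, forall x in D, a i (f x) == k i x]]].

Lemma homs_overP a (rT : finGroupType) (D : {set rT}) k (f : {ffun rT -> gT}) :
  reflect [/\ {in D &, {morph f : x y / (x * y)%g}},
              forall x, x \notin D -> f x = 1%g
            & forall i, {in D, forall x, a i (f x) = k i x}]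
          (f \in homs_over a D k).
Proof.
rewrite inE; apply: (iffP and3P) => [[/forall_inP h1 /forallP h2 /forallP h3]|[h1 h2 h3]].
  split=> [x y xD yD|x xD|i x xD].
  - by apply/eqP; apply: (forall_inP (h1 x xD)).
  - by apply/eqP; apply: (implyP (h2 x)).
  - by apply/eqP; apply: (forall_inP (h3 i)).
split.
- by apply/forall_inP=> x xD; apply/forall_inP=> y yD; rewrite h1.
- by apply/forallP=> x; apply/implyP=> xD; rewrite h2.
- by apply/forallP=> i; apply/forall_inP=> x xD; rewrite h3.
Qed.

(** A homomorphism from a cyclic group is determined by the image of the generator, which can be any
    element of order dividing [#[y]]; the character conditions need checking at [y] only. *)
Lemma card_homs_cycle a (rT : finGroupType) (y : rT) k :
  (forall i x z, a i (x * z)%g = a i x * a i z) ->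
  (forall i, {in <[y]>%g &, {morph k i : x z / (x * z)%g >-> x * z}}) ->
  (forall i, k i 1%g = 1) -> (forall i, a i 1%g = 1) ->
  #|homs_over a <[y]>%g k| =
  #|[set x : gT | (x ^+ #[y] == 1)%g && [forall i, a i x == k i y]]|.
Proof.
move=> aM kM k1 a1.
have inj : {in homs_over a <[y]>%g k &, injective (fun f : {ffun rT -> gT} => f y)}.
  have hX f n : f \in homs_over a <[y]>%g k -> f (y ^+ n)%g = (f y ^+ n)%g.
    case/homs_overP=> fM _ _; elim: n => [|n IHn].
      by rewrite !expg0; apply: (mulgI (f 1%g)); rewrite -fM ?group1 // !mulg1.
    by rewrite !expgS fM ?IHn ?mem_cycle ?cycle_id.
  move=> f h Ef Eh fh; apply/ffunP=> x.
  have [/cycleP[n ->]|xn] := boolP (x \in <[y]>%g); first by rewrite !hX ?fh.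
  by have [_ -> //] := homs_overP _ _ _ _ Ef; have [_ -> //] := homs_overP _ _ _ _ Eh.
rewrite -(card_in_imset inj); apply: eq_card => x; rewrite !inE.
apply/imsetP/andP => [[f /homs_overP[fM _ fk] ->]|[/eqP xy /forallP xk]].
  split; last by apply/forallP=> i; rewrite fk ?cycle_id.
  have hX n : f (y ^+ n)%g = (f y ^+ n)%g.
    elim: n => [|n IHn].
      by rewrite !expg0; apply: (mulgI (f 1%g)); rewrite -fM ?group1 // !mulg1.
    by rewrite !expgS fM ?IHn ?mem_cycle ?cycle_id.
  by rewrite -hX expg_order; apply/eqP; apply: (hX 0%N).
have dv : (#[x]%g %| #[y]%g)%N by rewrite order_dvdn xy.
exists [ffun z => if z \in <[y]>%g then eltm dv z else 1%g]; last first.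
  by rewrite ffunE cycle_id eltm_id.
apply/homs_overP; split=> [u v uy vy|u /negPf uy|i u uy].
- by rewrite !ffunE uy vy groupM // morphM.
- by rewrite ffunE uy.
rewrite ffunE uy; case/cycleP: uy => n ->; rewrite eltmE.
elim: n => [|n IHn]; first by rewrite !expg0 a1 k1.
by rewrite !expgS aM IHn kM ?mem_cycle ?cycle_id // (eqP (xk i)).
Qed.

(** Restriction to the two factors is a bijection: the target is commutative, so any pair of
    homomorphisms can be glued. *)
Lemma card_homs_dprod a (rT : finGroupType) (H K D : {group rT}) k :
  (forall i x z, a i (x * z)%g = a i x * a i z) ->
  (forall i, {in D &, {morph k i : x z / (x * z)%g >-> x * z}}) ->
  (H \x K = D)%g ->
  #|homs_over a D k| = (#|homs_over a H k| * #|homs_over a K k|)%N.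
Proof.
move=> aM kM dHK.
have sH : H \subset D by case/dprodP: dHK => _ <- _ _; apply: mulG_subl.
have sK : K \subset D by case/dprodP: dHK => _ <- _ _; apply: mulG_subr.
pose rs (E : {set rT}) (f : {ffun rT -> gT}) : {ffun rT -> gT} :=
  [ffun x => if x \in E then f x else 1%g].
have inj : {in homs_over a D k &, injective (fun f => (rs H f, rs K f))}.
  move=> f h /homs_overP[fM f0 _] /homs_overP[hM h0 _] [/ffunP eH /ffunP eK].
  apply/ffunP=> x; have [xD|xD] := boolP (x \in D); last by rewrite f0 ?h0.
  have [y yH [z zK ->]] : exists2 y, y \in H & exists2 z, z \in K & x = (y * z)%g.
    have [_ HK _ _] := dprodP dHK.
    by move: xD; rewrite -HK => /mulsgP[y z yH zK ->]; exists y => //; exists z.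
  rewrite fM ?hM ?(fintype.subsetP sH y) ?(fintype.subsetP sK z) //.
  by have := eH y; have := eK z; rewrite !ffunE yH zK => -> ->.
rewrite -cardsX -(card_in_imset inj); apply: eq_card => -[p q].
rewrite finset.in_setX; apply/imsetP/andP => [[f /homs_overP[fM f0 fk] [-> ->]]|[]].
  split; apply/homs_overP; split.
  - by move=> x y xH yH; rewrite !ffunE groupM ?xH ?yH // fM ?(fintype.subsetP sH).
  - by move=> x /negPf xH; rewrite ffunE xH.
  - by move=> i x xH; rewrite ffunE xH fk // (fintype.subsetP sH).
  - by move=> x y xH yH; rewrite !ffunE groupM ?xH ?yH // fM ?(fintype.subsetP sK).
  - by move=> x /negPf xH; rewrite ffunE xH.
  - by move=> i x xH; rewrite ffunE xH fk // (fintype.subsetP sK).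
case/homs_overP=> pM p0 pk /homs_overP[qM q0 qk].
pose pm := Morphism pM; pose qm := Morphism qM.
have cpq : (qm @* K)%g \subset ('C(pm @* H))%g.
  by apply: fintype.subset_trans (finset.subsetT _) (fintype.subset_trans cG (centS (finset.subsetT _))).
pose f := dprodm dHK cpq.
have fE : forall x y, x \in H -> y \in K -> f (x * y)%g = (p x * q y)%g.
  by move=> x y xH yK; rewrite /f dprodmE.
exists (rs D (finfun f)).
  apply/homs_overP; split=> [x y xD yD|x /negPf xD|i x xD].
  - by rewrite !ffunE groupM ?xD ?yD // /f morphM.
  - by rewrite ffunE xD.
  rewrite !ffunE xD; have [_ HK _ _] := dprodP dHK.
  move: xD; rewrite -HK => /mulsgP[y z yH zK ->].
  by rewrite fE // aM pk // qk // kM ?(fintype.subsetP sH y) ?(fintype.subsetP sK z).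
congr (_, _); apply/ffunP=> x; rewrite !ffunE.
  case: ifPn => [xH|/p0 //]; rewrite (fintype.subsetP sH) //= /f.
  by rewrite dprodmEl.
case: ifPn => [xK|/q0 //]; rewrite (fintype.subsetP sK) //= /f.
by rewrite dprodmEr.
Qed.

End HomCount.

(** * From equal joint counts on torsion subgroups to an automorphism *)

Section SameCounts.
Variables (gT : finGroupType) (F : fieldType) (I : finType) (L : nat).
Variables a b : I -> gT -> F.
Hypothesis cG : abelian [set: gT].
Hypothesis aM : forall i x z, a i (x * z)%g = a i x * a i z.
Hypothesis bM : forall i x z, b i (x * z)%g = b i x * b i z.
Hypothesis a1 : forall i, a i 1%g = 1.
Hypothesis b1 : forall i, b i 1%g = 1.
Hypothesis gL : forall x : gT, (x ^+ L)%g = 1%g.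
Hypothesis count_ab : forall d (k : I -> F), (d %| L)%N ->
  #|[set x : gT | (x ^+ d == 1)%g && [forall i, a i x == k i]]| =
  #|[set x : gT | (x ^+ d == 1)%g && [forall i, b i x == k i]]|.

(** Along a decomposition of [D] into cyclic factors both counts are products; on a factor generated
    by [y] they are the fibre counts of [count_ab] for [d = #[y]], a divisor of [L]. *)
Lemma eq_card_homs (rT : finGroupType) (D : {group rT}) k :
  abelian D -> (forall x : rT, x \in D -> (x ^+ L = 1)%g) ->
  (forall i, {in D &, {morph k i : x z / (x * z)%g >-> x * z}}) ->
  (forall i, k i 1%g = 1) ->
  #|homs_over a D k| = #|homs_over b D k|.
Proof.
move=> cD DL + k1; have [s defD _] := abelian_structure cD.
elim: s D {cD} DL defD => [|y s IHs] D DL defD kM.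
  have -> : (D : {set rT}) = <[1%g : rT]>%g by rewrite -defD big_nil cycle1.
  rewrite !card_homs_cycle // ?count_ab ?order1 ?dvd1n //.
    by move=> i x z /cycleP[n ->] /cycleP[m ->]; rewrite !expg1n mulg1 k1 mulr1.
  by move=> i x z /cycleP[n ->] /cycleP[m ->]; rewrite !expg1n mulg1 k1 mulr1.
move: defD; rewrite big_cons => defD.
case/dprodP: (defD) => [[H K eH eK] _ _ _]; rewrite eK eH in defD.
have sH : H \subset D by case/dprodP: defD => _ <- _ _; apply: mulG_subl.
have sK : K \subset D by case/dprodP: defD => _ <- _ _; apply: mulG_subr.
rewrite !(card_homs_dprod cG _ kM defD) //; congr (_ * _)%N; last first.
  apply: IHs => // [x xK|i x z xK zK]; first by rewrite DL // (fintype.subsetP sK).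
  by rewrite kM // (fintype.subsetP sK).
have kMy i : {in <[y]>%g &, {morph k i : x z / (x * z)%g >-> x * z}}.
  by move=> x z; rewrite eH => xH zH; rewrite kM // (fintype.subsetP sH).
rewrite -eH !card_homs_cycle // count_ab // order_dvdn DL //.
by rewrite (fintype.subsetP sH) // -eH cycle_id.
Qed.

(** The prescribed values are those of [a] for every [c]: with [c = a] and trivial [N] the identity
    qualifies, and with [c = b] the members carry [b] to [a]. *)
Definition endo_over (c : I -> gT -> F) (N : {set gT}) : {set {ffun gT -> gT}} :=
  [set f in homs_over c [set: gT] a | N \subset [set x | f x == 1%g]].

(** If some [a i] is nontrivial on [N], both sets are empty. Otherwise [a] factors through the
    quotient by [N], and the endomorphisms killing [N] are the homomorphisms from that quotient,
    counted by [eq_card_homs]. *)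
Lemma card_endo_over (N : {group gT}) : #|endo_over a N| = #|endo_over b N|.
Proof.
have nN : forall x, x \in 'N(N)%g.
  by move=> x; rewrite (fintype.subsetP (sub_abelian_norm cG (finset.subsetT _))) ?inE.
have [trN|] := boolP [forall i, forall x in N, a i x == 1]; last first.
  case/forallPn=> i /forall_inPn[x xN ax1].
  suff E0 c : (forall i, c i 1%g = 1) -> endo_over c N = finset.set0 by rewrite !E0.
  move=> c1; apply/setP=> f; rewrite !inE; apply/negP=> /andP[].
  case/and3P=> _ _ /forallP/(_ i)/forall_inP/(_ x (finset.in_setT _)) + /fintype.subsetP/(_ x xN).
  by rewrite inE => + /eqP fx; rewrite fx c1 eq_sym (negPf ax1).
have aN i x y : coset N x = coset N y -> a i x = a i y.
  move/(rcoset_kercosetP (nN x) (nN y))/rcosetP => [n nN' ->].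
  by rewrite aM (eqP (forall_inP (forallP trN i) n nN')) mul1r.
pose k (i : I) (X : coset_of N) := a i (repr X).
have kE i x : k i (coset N x) = a i x by apply: aN; rewrite coset_reprK.
have kM i (X Y : coset_of N) : k i (X * Y)%g = k i X * k i Y.
  rewrite -[X]coset_reprK -[Y]coset_reprK -morphM ?nN // !kE.
  exact: aM.
suff cE c : (forall i, c i 1%g = 1) ->
    #|endo_over c N| = #|homs_over c [set: coset_of N] k|.
  rewrite !cE //; apply: eq_card_homs => [|X _|i X Y _ _|i].
  - apply/centsP=> X _ Y _; rewrite /commute -[X]coset_reprK -[Y]coset_reprK.
    by rewrite -!morphM ?nN // (centsP cG) ?inE.
  - by rewrite -[X]coset_reprK -morphX ?nN // gL morph1.
  - exact: kM.
  - by rewrite -[1%g](coset_id (group1 N)) kE a1.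
move=> c1.
pose lift (h : {ffun coset_of N -> gT}) : {ffun gT -> gT} := [ffun x => h (coset N x)].
have liftI : injective lift.
  move=> h g /ffunP e; apply/ffunP=> X; have := e (repr X).
  by rewrite !ffunE coset_reprK.
rewrite -(card_imset _ liftI); apply: eq_card => f; rewrite inE.
apply/andP/imsetP => [[/homs_overP[fM _ fk] /fintype.subsetP fN]|[h /homs_overP[hM _ hk] ->]].
  have fN1 n x : n \in N -> f (n * x)%g = f x.
    by move=> nN'; rewrite fM ?inE //; have := fN n nN'; rewrite inE => /eqP->; rewrite mul1g.
  have fE x y : coset N x = coset N y -> f x = f y.
    move/(rcoset_kercosetP (nN x) (nN y))/rcosetP => [n nN' ->]; apply: (fN1 _ _ nN').
  pose h : {ffun coset_of N -> gT} := [ffun X : coset_of N => f (repr X)].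
  have hE x : h (coset N x) = f x by rewrite ffunE; apply: fE; rewrite coset_reprK.
  exists h; last by apply/ffunP=> x; rewrite ffunE hE.
  apply/homs_overP; split=> [X Y _ _|X|i X _]; last 2 first.
  - by rewrite inE.
  - by rewrite -[X]coset_reprK hE kE fk ?inE.
  by rewrite -[X]coset_reprK -[Y]coset_reprK -morphM ?nN // !hE fM ?inE.
have h1 : h 1%g = 1%g by apply: (mulgI (h 1%g)); rewrite -hM ?inE // !mulg1.
split; last by apply/fintype.subsetP=> n nN'; rewrite inE ffunE coset_id ?h1.
apply/homs_overP; split=> [x y _ _|x|i x _]; last 2 first.
- by rewrite inE.
- by rewrite ffunE hk ?inE.
by rewrite !ffunE morphM ?nN // hM ?inE.
Qed.

Lemma hom_preim1_group c (f : {ffun gT -> gT}) : f \in homs_over c [set: gT] a ->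
  group_set [set x | f x == 1%g].
Proof.
case/homs_overP=> fM _ _; apply/group_setP; split=> [|x y].
  by rewrite inE; apply/eqP/(mulgI (f 1%g)); rewrite -fM ?inE // !mulg1.
by rewrite !inE fM ?inE // => /eqP-> /eqP->; rewrite mulg1.
Qed.

(** Inversion over the subgroup lattice: the endomorphisms with kernel exactly [N] are those with
    kernel containing [N], minus those with a strictly larger kernel, which are settled by induction
    on the index gap. *)
Lemma card_endo_kernel (N : {group gT}) :
  #|[set f in homs_over a [set: gT] a | [set x | f x == 1%g] == N]| =
  #|[set f in homs_over b [set: gT] a | [set x | f x == 1%g] == N]|.
Proof.
have [m] := ubnP (#|[set: gT]| - #|N|)%N; elim: m N => // m IHm N ltN.
have split_count c : #|endo_over c N| =
    (#|[set f in homs_over c [set: gT] a | [set x | f x == 1%g] == N]| +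
     \sum_(M : {group gT} | N \proper M)
       #|[set f in homs_over c [set: gT] a | [set x | f x == 1%g] == M]|)%N.
  (* Taking the generated subgroup gives a group for every function [f], as [partition_big]
     requires; for an endomorphism it changes nothing. *)
  pose ker (f : {ffun gT -> gT}) := <<[set x | f x == 1%g]>>%G.
  have kerE f : f \in homs_over c [set: gT] a -> ker f = [set x | f x == 1%g] :> {set gT}.
    by move/hom_preim1_group=> gr; apply: (gen_set_id gr).
  rewrite -sum1_card (partition_big ker (fun M : {group gT} => N \subset M)) /=; last first.
    by move=> f; rewrite inE => /andP[/kerE kf]; rewrite kf.
  have fibre (M : {group gT}) : N \subset M ->
      (\sum_(f in endo_over c N | ker f == M) 1)%N =
      #|[set f in homs_over c [set: gT] a | [set x | f x == 1%g] == M]|.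
    move=> NM; rewrite -sum1_card; apply: eq_bigl => f.
    rewrite [f \in endo_over c N]finset.in_set [in RHS]finset.in_set -!andbA.
    have [fH|//] := boolP (f \in homs_over c [set: gT] a).
    have -> : (ker f == M) = ([set x | f x == 1%g] == M) by rewrite -(kerE f fH).
    by case: eqP => [->|]; rewrite ?NM ?andbF.
  rewrite (bigD1 N) //= fibre //; congr (_ + _)%N.
  rewrite (eq_bigl (fun M : {group gT} => N \proper M)) => [|M].
    by apply: eq_bigr => M /proper_sub; apply: fibre.
  by rewrite finset.properEneq eq_sym andbC.
have := card_endo_over N; rewrite !split_count.
under eq_bigr => M prM.
  rewrite IHm; first over.
  apply: leq_trans (_ : _ <= #|[set: gT]| - #|N|)%N _; last by rewrite -ltnS.
  apply: ltn_sub2l (proper_card prM).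
  exact: leq_trans (proper_card prM) (subset_leq_card (finset.subsetT M)).
by move/addIn.
Qed.

(* The identity is an injective endomorphism carrying a to a, so by
   card_endo_kernel there is an injective one carrying b to a. *)
Lemma exists_aut_over : exists2 s : {perm gT}, s \in Aut [set: gT] &
  forall i x, b i (s x) = a i x.
Proof.
have := card_endo_kernel 1%G.
set A := [set f in _ | _]; set B := [set f in _ | _] => cAB.
have idA : [ffun x => x] \in A.
  rewrite inE; apply/andP; split.
    by apply/homs_overP; split=> [x y _ _|x|i x _]; rewrite ?ffunE ?inE.
  by apply/eqP/setP=> x; rewrite !inE ffunE.
have /card_gt0P[f] : (0 < #|B|)%N by rewrite -cAB; apply/card_gt0P; exists [ffun x => x].
rewrite inE => /andP[/homs_overP[fM _ fk] /eqP/setP f1].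
have fI : injective f.
  move=> x y fxy; have fxy1 : f (x * y^-1)%g = 1%g.
    by apply: (mulIg (f y)); rewrite -fM ?inE // mulgKV mul1g.
  have : (x * y^-1)%g \in [set z | f z == 1%g] by rewrite inE fxy1.
  by rewrite f1 => /finset.set1P /eqP; rewrite -eq_mulgV1 => /eqP.
exists (perm fI); last by move=> i x; rewrite permE fk ?inE.
rewrite inE; apply/andP; split.
  by apply/fintype.subsetP=> x; rewrite !inE.
by apply/morphicP=> x y _ _; rewrite !permE fM ?inE.
Qed.

End SameCounts.

(** * Relations between characters determine the joint counts *)

Section Annihilators.
Variables (gT : finGroupType) (F : numFieldType) (I : finType) (L : nat).
Hypothesis cG : abelian [set: gT].
Hypothesis L_gt0 : (0 < L)%N.

Definition char_comb (a : I -> gT -> F) (c : {ffun I -> 'I_L}) (x : gT) : F :=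
  \prod_i a i x ^+ c i.

Definition annihilates (a : I -> gT -> F) (d : nat) (c : {ffun I -> 'I_L}) : bool :=
  [forall x : gT, (x ^+ d == 1)%g ==> (char_comb a c x == 1)].

Lemma char_combM a c x y :
  (forall i x z, a i (x * z)%g = a i x * a i z) ->
  char_comb a c (x * y)%g = char_comb a c x * char_comb a c y.
Proof.
by move=> aM; rewrite -big_split; apply: eq_bigr => i _; rewrite aM exprMn.
Qed.

Lemma char_comb1 a c : (forall i, a i 1%g = 1) -> char_comb a c 1%g = 1.
Proof. by move=> a1; apply: big1 => i _; rewrite a1 expr1n. Qed.

(** Each condition [a i x = k i] is detected by a geometric sum over [L]-th roots of unity.
    Expanding the product leaves sums of homomorphisms over the torsion subgroup, so the count
    depends on [a] only through [annihilates]. *)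
Lemma card_torsion_fibre (a : I -> gT -> F) d (k : I -> F) :
  (forall i x z, a i (x * z)%g = a i x * a i z) -> (forall i, a i 1%g = 1) ->
  (forall i x, a i x ^+ L = 1) -> (forall i, k i ^+ L = 1) ->
  #|[set x : gT | (x ^+ d == 1)%g && [forall i, a i x == k i]]|%:R *
    \prod_(i : I) L%:R =
  \sum_(c : {ffun I -> 'I_L}) (\prod_i (k i)^-1 ^+ c i) *
    (if annihilates a d c then #|[set x : gT | (x ^+ d == 1)%g]|%:R else 0) :> F.
Proof.
move=> aM a1 aL kL.
have kN0 i : k i != 0.
  by apply: contra_eq_neq (kL i) => ->; rewrite expr0n gtn_eqF // eq_sym oner_eq0.
transitivity (\sum_(x : gT | (x ^+ d == 1)%g) \prod_i \sum_(c < L) (a i x / k i) ^+ c).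
  rewrite (bigID (fun x : gT => [forall i, a i x == k i])) /= [X in _ + X]big1 ?addr0.
    rewrite cardsE mulr_natl -sumr_const; apply: eq_bigr => x /andP[_ /forallP ax].
    apply: eq_bigr => i _; rewrite (eqP (ax i)) divff // sum_expr_root1 ?eqxx //.
    by rewrite expr1n.
  move=> x /andP[_ /forallPn[i ai]]; rewrite (bigD1 i) //= sum_expr_root1.
    case: eqP => [/divr1_eq e|]; last by rewrite mul0r.
    by rewrite e eqxx in ai.
  by rewrite expr_div_n aL kL divr1.
under eq_bigr do rewrite bigA_distr_bigA.
rewrite exchange_big /=; apply: eq_bigr => c _.
rewrite -(sum_torsion_hom d cG _ (char_comb1 c a1)).
  rewrite mulr_sumr; apply: eq_bigr => x _; rewrite -big_split; apply: eq_bigr => i _.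
  by rewrite exprMn mulrC.
by move=> x y; rewrite char_combM.
Qed.

Lemma aut_of_annihilators (a b : I -> gT -> F) :
  (forall i x z, a i (x * z)%g = a i x * a i z) ->
  (forall i x z, b i (x * z)%g = b i x * b i z) ->
  (forall i x, a i x ^+ L = 1) -> (forall i x, b i x ^+ L = 1) ->
  (forall x : gT, (x ^+ L)%g = 1%g) ->
  (forall d c, (d %| L)%N -> annihilates a d c = annihilates b d c) ->
  exists2 s : {perm gT}, s \in Aut [set: gT] & forall i x, b i (s x) = a i x.
Proof.
move=> aM bM aL bL gL ab.
have one (u : I -> gT -> F) i : (forall i x z, u i (x * z)%g = u i x * u i z) ->
    (forall i x, u i x ^+ L = 1) -> u i 1%g = 1.
  move=> uM uL; have uN0 : u i 1%g != 0.
    by apply: contra_eq_neq (uL i 1%g) => ->; rewrite expr0n gtn_eqF // eq_sym oner_eq0.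
  by apply: (mulfI uN0); rewrite -uM mulg1 mulr1.
apply: (@exists_aut_over _ _ _ L) => // [i|i|d k dL]; [exact: one|exact: one|].
have [/forallP kL|/forallPn[i kL]] := boolP [forall i, k i ^+ L == 1].
  have LN0 : \prod_(i : I) L%:R != 0 :> F.
    by apply/prodf_neq0 => i _; rewrite pnatr_eq0 -lt0n.
  apply/eqP; rewrite -(eqr_nat F); apply/eqP/(mulIf LN0).
  rewrite !card_torsion_fibre // => [|i|i|i|i]; try exact: one; try exact: (eqP (kL i)).
  by apply: eq_bigr => c _; rewrite ab.
(* A tuple [k] with an entry that is not an [L]-th root of unity is attained by neither family. *)
suff e0 (u : I -> gT -> F) : (forall i x, u i x ^+ L = 1) ->
    [set x : gT | (x ^+ d == 1)%g && [forall i, u i x == k i]] = finset.set0 by rewrite !e0.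
move=> uL; apply/setP=> x; rewrite !inE; apply/negP=> /andP[_ /forallP/(_ i)/eqP e].
by rewrite -e uL eqxx in kL.
Qed.
End Annihilators.

(** * Fourier analysis *)

Section ComplexNorm.
Variable R : realType.
Implicit Types z w : R[i].

Definition cabs z : R := ComplexField.Normc.normc z.

Lemma cabsE z : `|z| = (cabs z)%:C%C.
Proof. by rewrite normc_def; case: z. Qed.

Lemma cabs_ge0 z : 0 <= cabs z.
Proof. by rewrite /cabs; case: z => a b; apply: sqrtr_ge0. Qed.

Lemma cabs0 : cabs 0 = 0. Proof. exact: ComplexField.Normc.normc0. Qed.

Lemma cabs1 : cabs 1 = 1. Proof. exact: ComplexField.Normc.normc1. Qed.

Lemma cabsM z w : cabs (z * w) = cabs z * cabs w.
Proof. exact: ComplexField.Normc.normcM. Qed.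

Lemma cabsD z w : cabs (z + w) <= cabs z + cabs w.
Proof. exact: le_normcD. Qed.

Lemma cabsN z : cabs (- z) = cabs z. Proof. exact: normcN. Qed.

Lemma cabsB z w : cabs (z - w) <= cabs z + cabs w.
Proof. by rewrite -(cabsN w) cabsD. Qed.

Lemma cabs_distC z w : cabs (z - w) = cabs (w - z).
Proof. by rewrite -cabsN opprB. Qed.

Lemma cabs_conj z : cabs z^*%R = cabs z.
Proof. by apply: complexI; rewrite -!cabsE norm_conjC. Qed.

Lemma cabs_real (x : R) : cabs x%:C%C = `|x|.
Proof. by rewrite /cabs /= expr0n addr0 sqrtr_sqr. Qed.

Lemma mul_conj_cabs z : z * z^*%R = (cabs z ^+ 2)%:C%C.
Proof. by rewrite -normCK cabsE rmorphXn. Qed.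

Lemma cabs_sum (I : finType) (P : pred I) (G : I -> R[i]) :
  cabs (\sum_(i | P i) G i) <= \sum_(i | P i) cabs (G i).
Proof.
elim/big_ind2: _ => [|x1 x2 y1 y2 h1 h2|//]; first by rewrite cabs0.
exact: le_trans (cabsD _ _) (lerD h1 h2).
Qed.

Lemma normr_Re_le z : `|complex.Re z| <= cabs z.
Proof.
by case: z => a b /=; rewrite -sqrtr_sqr ler_wsqrtr // lerDl sqr_ge0.
Qed.

Lemma cabs_unity z n : (0 < n)%N -> z ^+ n = 1 -> cabs z = 1.
Proof.
move=> n0 zn; have : cabs z ^+ n = 1.
  by rewrite -cabs1 -zn; elim: n {n0 zn} => [|n IH]; rewrite ?expr0 ?cabs1 // !exprS cabsM IH.
by move/eqP; rewrite pexpr_eq1 ?cabs_ge0 // => /eqP.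
Qed.

Lemma conj_unity z n : (0 < n)%N -> z ^+ n = 1 -> z^*%R = z^-1.
Proof.
move=> n0 zn; have z0 : z != 0.
  by apply: contra_eq_neq zn => ->; rewrite expr0n gtn_eqF // eq_sym oner_eq0.
by apply: (mulfI z0); rewrite mul_conj_cabs (cabs_unity n0 zn) expr1n divff.
Qed.

End ComplexNorm.

(* A self-dual enumeration of the characters of a finite abelian group: r and x
   play symmetric roles in chi r x. *)
Record self_dual (R : realType) (gT : finGroupType) (L : nat)
    (chi : gT -> gT -> R[i]) : Prop := SelfDual {
  sd_abelian : abelian [set: gT];
  sd_gt0 : (0 < L)%N;
  sd_exponent : forall x : gT, (x ^+ L)%g = 1%g;
  sd_morph : forall r x y, chi r (x * y)%g = chi r x * chi r y;
  sd_sym : forall r x, chi r x = chi x r;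
  sd_unity : forall r x, chi r x ^+ L = 1;
  sd_nondeg : forall x, (forall r, chi r x = 1) -> x = 1%g }.

Section FourierAnalysis.
Variables (R : realType) (gT : finGroupType) (L : nat) (chi : gT -> gT -> R[i]).
Hypothesis sd : self_dual L chi.

Let G : R[i] := #|gT|%:R.

Lemma card_gT_neq0 : #|gT|%:R != 0 :> R[i].
Proof. by rewrite pnatr_eq0 -lt0n; apply/card_gt0P; exists 1%g. Qed.
Local Notation GN0 := card_gT_neq0.

Lemma chi_neq0 r x : chi r x != 0.
Proof.
apply: contra_eq_neq (sd_unity sd r x) => ->.
by rewrite expr0n gtn_eqF ?(sd_gt0 sd) // eq_sym oner_eq0.
Qed.

Lemma chi_1 r : chi r 1%g = 1.
Proof. by apply: (mulfI (chi_neq0 r 1%g)); rewrite -(sd_morph sd) mulg1 mulr1. Qed.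

Lemma chi_conj r x : (chi r x)^*%R = (chi r x)^-1.
Proof. exact: conj_unity (sd_gt0 sd) (sd_unity sd r x). Qed.

Lemma chi_inv r x : chi r x^-1%g = (chi r x)^*%R.
Proof.
by rewrite chi_conj; apply: (mulfI (chi_neq0 r x)); rewrite -(sd_morph sd) mulgV chi_1 divff ?chi_neq0.
Qed.

Lemma cabs_chi r x : cabs (chi r x) = 1.
Proof. exact: cabs_unity (sd_gt0 sd) (sd_unity sd r x). Qed.

Lemma sum_hom (u : gT -> R[i]) :
  (forall x y, u (x * y)%g = u x * u y) -> (exists x, u x != 1) ->
  \sum_x u x = 0.
Proof.
move=> uM [y uy]; set s := \sum_x _; suff: s = s * u y.
  move/eqP; rewrite -subr_eq0 -{1}[s]mulr1 -mulrBr mulf_eq0 subr_eq0.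
  by rewrite [1 == _]eq_sym (negPf uy) orbF => /eqP.
by rewrite {1}/s (reindex_inj (mulIg y)) /= mulr_suml; apply: eq_bigr => x _.
Qed.

Lemma sum_chi x : \sum_r chi r x = if x == 1%g then G else 0.
Proof.
case: eqP => [->|x1].
  by under eq_bigr do rewrite chi_1; rewrite sumr_const.
under eq_bigr do rewrite (sd_sym sd).
have /existsP nt : [exists r, chi x r != 1].
  apply: contra_notT x1 => /existsPn h.
  by apply: (sd_nondeg sd) => r; rewrite (sd_sym sd); apply/eqP; rewrite -[_ == _]negbK h.
by apply: sum_hom => // r s; apply: (sd_morph sd).
Qed.

Lemma chi_orthogonal x y :
  \sum_r chi r x * (chi r y)^*%R = if x == y then G else 0.
Proof.
under eq_bigr do rewrite -chi_inv -(sd_morph sd).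
by rewrite sum_chi -eq_mulgV1.
Qed.

Lemma fourier_inv (h : gT -> R[i]) x : h x = \sum_r fourier h (chi r) * chi r x.
Proof.
rewrite /fourier; under eq_bigr do rewrite -mulrA mulr_suml.
rewrite -mulr_sumr exchange_big /= (bigD1 x) //= [X in _ * (_ + X)]big1 => [|y yx].
  under eq_bigr do rewrite -mulrA [_^*%R * _]mulrC.
  by rewrite -mulr_sumr chi_orthogonal eqxx addr0 mulrC mulfK ?GN0.
under eq_bigr do rewrite -mulrA [_^*%R * _]mulrC.
by rewrite -mulr_sumr chi_orthogonal eq_sym (negPf yx) mulr0.
Qed.

(** The homomorphism [chi r \o s] is nonzero, so by Fourier inversion it has a nonzero coefficient
    at some character; two homomorphisms with nonzero correlation are equal. *)
Lemma chi_comp_aut (s : {perm gT}) r : s \in Aut [set: gT] ->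
  exists r', forall x, chi r' x = chi r (s x).
Proof.
move=> sA; have sM x y : s (x * y)%g = (s x * s y)%g.
  by have /morphicP -> := Aut_morphic sA; rewrite ?inE.
pose u x := chi r (s x).
have uM x y : u (x * y)%g = u x * u y by rewrite /u sM (sd_morph sd).
have s1 : s 1%g = 1%g by apply: (mulgI (s 1%g)); rewrite -sM !mulg1.
have [/forallP h|] := boolP [forall r', fourier u (chi r') == 0].
  have := fourier_inv u 1%g; rewrite big1 => [|r' _]; last by rewrite (eqP (h r')) mul0r.
  by rewrite /u s1 chi_1 => /eqP; rewrite oner_eq0.
case/forallPn=> r' nz; exists r' => x; apply/eqP.
apply: contra_neqT nz => nex; rewrite /fourier sum_hom ?mulr0 //.
  by move=> y z; rewrite uM (sd_morph sd) rmorphM mulrACA.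
exists x; rewrite chi_conj; apply: contra nex => /eqP/divr1_eq <-.
by rewrite /u.
Qed.

Section RealFunctions.
Variable g : gT -> R[i].
Hypothesis gJ : forall x, (g x)^*%R = g x.

Definition spec (r : gT) : R := cabs (fourier g (chi r)) ^+ 2.

Lemma spec_ge0 r : 0 <= spec r. Proof. exact: sqr_ge0. Qed.

(** The Wiener-Khinchin identity; since [g] is real, the sum against [chi r c] is the conjugate of
    the one defining the coefficient. *)
Lemma autocorrelation y :
  \sum_c g c * g (c * y)%g = G * \sum_r (spec r)%:C%C * chi r y.
Proof.
under eq_bigr do rewrite (fourier_inv g (_ * y)%g) mulr_sumr.
rewrite exchange_big mulr_sumr; apply: eq_bigr => r _ /=.
rewrite /spec -mul_conj_cabs mulrA -mulrA mulrCA -mulrA.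
transitivity (fourier g (chi r) * chi r y * (\sum_c g c * (chi r c)^*%R)^*%R).
  rewrite rmorph_sum mulr_sumr; apply: eq_bigr => c _.
  by rewrite rmorphM /= conjCK gJ (sd_morph sd); ring.
rewrite -mulrA; congr (_ * _); rewrite mulrC mulrA; congr (_ * _).
by rewrite /fourier rmorphM /= fmorphV /= conjC_nat [RHS]mulrC mulVKf ?GN0.
Qed.

End RealFunctions.
End FourierAnalysis.

(** * Concentration *)

Section Markov.
Variables (R : realType) (T : finType).

Lemma markov_card (P : {set T}) (f : T -> R) (t : R) : 0 < t ->
  (forall x, 0 <= f x) ->
  #|[set x in P | t <= f x]|%:R * t <= \sum_(x in P) f x.
Proof.
move=> t0 f0; rewrite mulr_natl cardsE -sumr_const.
rewrite [leRHS](bigID (fun x => t <= f x)) /=.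
apply: ler_wpDr; first exact: sumr_ge0.
rewrite (eq_bigl (fun x => (x \in P) && (t <= f x))); first by apply: ler_sum => x /andP[].
by move=> x.
Qed.
End Markov.

(** * Independence of the coordinates in a product of finite sets *)

Section ProductFamily.
Variables (D T : finType) (Q : D -> {set T}).
Local Notation fam := (family (fun e => mem (Q e))).

Lemma card_family_prod : #|fam| = (\prod_e #|Q e|)%N.
Proof.
by rewrite card_family foldrE big_map big_enum.
Qed.

(** The points satisfying all constraints form a product again, in which each factor indexed by [S]
    has shrunk by at least one half. *)
Lemma card_family_forall (S : {set D}) (P : D -> pred T) :
  (forall e, e \in S -> (#|[set t in Q e | P e t]| * 2 <= #|Q e|)%N) ->
  (#|[set x : {ffun D -> T} | (x \in fam) && [forall e in S, P e (x e)]]| * 2 ^ #|S|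
    <= #|fam|)%N.
Proof.
move=> half; pose Q' e := if e \in S then [set t in Q e | P e t] else Q e.
have -> : #|[set x : {ffun D -> T} | (x \in fam) && [forall e in S, P e (x e)]]| =
    (\prod_e #|Q' e|)%N.
  transitivity #|family (fun e => mem (Q' e))|.
    apply: eq_card => x; rewrite inE; apply/andP/familyP => [[/familyP xQ /forall_inP xP] e|xQ].
      by rewrite /Q'; case: ifPn => eS; rewrite ?inE ?xP ?andbT //; apply: xQ.
    split; first by apply/familyP=> e; have := xQ e; rewrite /Q'; case: ifP; rewrite ?inE // => _ /andP[].
    by apply/forall_inP=> e eS; have := xQ e; rewrite /Q' eS !inE => /andP[].
  by rewrite card_family foldrE big_map big_enum.
rewrite card_family_prod -prod_nat_const [(\prod_(e in S) 2)%N]big_mkcond -big_split /=.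
by apply: leq_prod => e _; rewrite /Q'; case: ifPn => [/half//|_]; rewrite muln1.
Qed.

Variable R : realType.

(** The sum factors over the coordinates, and the factor at [e] is zero. *)
Lemma sum_family_uncorrelated (e e' : D) (h h' : T -> R[i]) :
  e != e' -> \sum_(t in Q e) h t = 0 ->
  \sum_(x in fam) h (x e) * h' (x e') = 0.
Proof.
move=> ne h0.
pose F e0 t := if e0 == e then h t else if e0 == e' then h' t else 1.
transitivity (\prod_e0 \sum_(t in Q e0) F e0 t); last first.
  by rewrite (bigD1 e) //= /F eqxx h0 mul0r.
rewrite (bigA_distr_big_dep (fun e => mem (Q e))); apply: eq_bigr => x _.
rewrite (bigD1 e) //= (bigD1 e') 1?eq_sym //= big1 => [|e0 /andP[/negPf e1 /negPf e2]].
  by rewrite /F eqxx eq_sym (negPf ne) eqxx mulr1.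
by rewrite /F e1 e2.
Qed.
End ProductFamily.

(** * An exponential tail bound for means of bounded independent samples *)

Section Hoeffding.
Variable R : realType.

(** From [1 - y <= expR (- y)] one gets [(1 - y) * expR y <= 1], while [(1 - y) * (1 + y + 2 * y ^+
    2) = 1 + y ^+ 2 * (1 - 2 * y)] is at least 1. *)
Lemma expR_le_quadratic (y : R) : y <= 1 / 2 -> expR y <= 1 + y + 2 * y ^+ 2.
Proof.
move=> y2; have y1 : 0 < 1 - y by lra.
rewrite -(ler_pM2r y1); apply: (@le_trans _ _ 1).
  by rewrite -[leRHS](expRxMexpNx_1 y) ler_wpM2l ?expR_ge0 // -[- y]addr0 expR_ge1Dx.
nra.
Qed.

Variables (T : finType) (V : T -> R) (mu : R) (S : nat).
Hypothesis V1 : forall t, `|V t| <= 1.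
Hypothesis mean : \sum_t V t = #|T|%:R * mu.
Hypothesis mu1 : `|mu| <= 1.

Lemma hoeffding_upper (eta : R) : 0 < eta <= 1 ->
  #|[set w : {ffun 'I_S -> T} | S%:R * (mu + eta) <= \sum_j V (w j)]|%:R
    <= expR (- (S%:R * eta ^+ 2 / 32)) * #|T|%:R ^+ S.
Proof.
(* This [lam] maximizes [lam * eta - 8 * lam ^+ 2], with value [eta ^+ 2 / 32]; as [V t - mu] is at
   most 2, it also keeps the exponents below 1/2. *)
case/andP=> eta0 eta1; pose lam := eta / 16.
have lam0 : 0 < lam by rewrite divr_gt0.
pose f (w : {ffun 'I_S -> T}) := \prod_j expR (lam * (V (w j) - mu)).
have total : \sum_w f w <= (#|T|%:R * expR (8 * lam ^+ 2)) ^+ S.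
  rewrite /f -(bigA_distr_bigA (fun _ t => expR (lam * (V t - mu)))) prodr_const card_ord.
  apply: lerXn2r.
  - by rewrite nnegrE; apply: sumr_ge0 => t _; apply: expR_ge0.
  - by rewrite nnegrE mulr_ge0 ?expR_ge0.
  apply: (@le_trans _ _ (\sum_t (1 + lam * (V t - mu) + 8 * lam ^+ 2))).
    apply: ler_sum => t _; have := V1 t; rewrite ler_norml => /andP[v1 v2].
    move: mu1; rewrite ler_norml => /andP[m1 m2].
    apply: le_trans (expR_le_quadratic _) _; first by rewrite /lam; nra.
    rewrite lerD2l exprMn; have : (V t - mu) ^+ 2 <= 4 by nra.
    have := sqr_ge0 lam; nra.
  have -> : \sum_t (1 + lam * (V t - mu) + 8 * lam ^+ 2) = #|T|%:R * (1 + 8 * lam ^+ 2).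
    rewrite !big_split /= -mulr_sumr sumrB mean !sumr_const.
    by rewrite -[mu *+ _]mulr_natl -[(8 * _) *+ _]mulr_natl; ring.
  by rewrite ler_wpM2l // expR_ge1Dx.
pose t := expR (lam * (S%:R * eta)).
have t0 : 0 < t by exact: expR_gt0.
rewrite -(ler_pM2r t0).
have f0 w : 0 <= f w by apply: prodr_ge0 => j _; apply: expR_ge0.
apply: (@le_trans _ _ (\sum_w f w)).
  have := markov_card [set: {ffun 'I_S -> T}] t0 f0.
  rewrite [leRHS](eq_bigl predT) => [|w]; last by rewrite inE.
  apply: le_trans; rewrite ler_wpM2r ?(ltW t0) // ler_nat.
  apply/subset_leq_card/fintype.subsetP => w; rewrite !inE /= /f /t -expR_sum ler_expR -mulr_sumr.
  by rewrite ler_pM2l // sumrB sumr_const card_ord -mulr_natl mulrDr; lra.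
apply: le_trans total _; rewrite exprMn mulrC mulrAC ler_wpM2r ?exprn_ge0 //.
rewrite -expRM_natl /t -expRD ler_expR /lam.
by have := ler0n R S; nra.
Qed.

End Hoeffding.

(** * Samples that determine the heavy coefficients up to automorphism *)

Section Samples.
Variables (R : realType) (gT : finGroupType) (L : nat) (chi : gT -> gT -> R[i]).
Hypothesis sd : self_dual L chi.
Variables (M S : nat) (gam delta : R).

Local Notation D := ('I_L.+1 * 'I_M)%type.
Local Notation coefs := {ffun D -> 'I_L}.
Implicit Types (x : {ffun D -> gT}) (w : {ffun 'I_S -> gT * coefs}) (g : gT -> R[i]).

Definition char_prod (c : gT -> nat) (y : gT) : R[i] := \prod_r chi r y ^+ c r.

Definition same_on x (r r' : gT) : bool := [forall e, chi r (x e) == chi r' (x e)].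

(** In an abelian group of exponent dividing [L], exponents below [L] reach the whole subgroup
    generated by the points of [x], and uniform [k] gives a uniform element of it. *)
Definition subset_word x (k : coefs) : gT := (\prod_e x e ^+ k e)%g.

Definition hat g (r : gT) : R[i] := fourier g (chi r).

Definition large g : {set gT} := [set r | delta <= spec chi g r].

Definition bucket g x (r : gT) : R := \sum_(r' | same_on x r r') spec chi g r'.

(** An unbiased one-pair estimator of [bucket g x r], with absolute value at most 1 when [g] has
    values of modulus 1; the real part is harmless since the mean is real. *)
Definition correlation g x (r : gT) (ck : gT * coefs) : R :=
  complex.Re (g ck.1 * g (ck.1 * subset_word x ck.2)%g * (chi r (subset_word x ck.2))^*%R).

(* The sample x holds M points of the d-torsion subgroup for each d <= L; since
   y ^+ 0 = 1, those of index (0, j) range over the whole group. *)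
Record good_points g x : Prop := GoodPoints {
  gp_torsion : forall e, (x e ^+ e.1 = 1)%g;
  gp_type : forall (d : 'I_L.+1) (c : gT -> nat),
    (forall r, r \notin large g -> c r = 0%N) ->
    (forall j, char_prod c (x (d, j)) = 1) ->
    forall y : gT, (y ^+ d = 1)%g -> char_prod c y = 1;
  gp_small : \sum_(r | r \notin large g)
    \sum_(r' | (r' \notin large g) && same_on x r r') spec chi g r * spec chi g r' <= gam ^+ 4;
  gp_coef : forall r, 9 * gam ^+ 2 <= spec chi g r ->
    cabs (M%:R^-1 * (\sum_j g (x (ord0, j)) * (chi r (x (ord0, j)))^*%R) - hat g r) <= gam }.

Definition good_shifts g x w : Prop := forall r,
  `| S%:R^-1 * (\sum_j correlation g x r (w j)) - bucket g x r | <= gam ^+ 2.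

Definition agree g g' x w : Prop :=
  [/\ forall j, g (x (ord0, j)) = g' (x (ord0, j)),
      forall j, g (w j).1 = g' (w j).1
    & forall j, g ((w j).1 * subset_word x (w j).2)%g =
                g' ((w j).1 * subset_word x (w j).2)%g].

Lemma same_onP x r r' : reflect (forall e, chi r (x e) = chi r' (x e)) (same_on x r r').
Proof. by apply: (iffP forallP) => h e; apply/eqP; rewrite h. Qed.

Lemma chi_inj r r' : (forall y, chi r y = chi r' y) -> r = r'.
Proof.
move=> h; apply/eqP; rewrite eq_mulgV1; apply/eqP/(sd_nondeg sd) => y.
rewrite (sd_morph sd) (chi_inv sd) (chi_conj sd) (sd_sym sd y) h (sd_sym sd y).
by rewrite divff ?(chi_neq0 sd).
Qed.

Lemma eq_correlation g g' x w r j : agree g g' x w ->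
  correlation g x r (w j) = correlation g' x r (w j).
Proof. by case=> _ h1 h2; rewrite /correlation h1 h2. Qed.

Section Good.
Variables (g : gT -> R[i]) (x : {ffun D -> gT}).
Hypothesis gd : good_points g x.

(** The square of the small mass in one class is the contribution of that class to the collision sum
    in [gp_small]. *)
Lemma bucket_small r :
  0 <= gam -> \sum_(r' | (r' \notin large g) && same_on x r r') spec chi g r' <= gam ^+ 2.
Proof.
move=> g0; set s := \sum_(r' | _) _.
have s0 : 0 <= s by apply: sumr_ge0 => r' _; apply: spec_ge0.
rewrite -(@ler_pXn2r _ 2) ?nnegrE ?exprn_ge0 // -exprM.
apply: le_trans (gp_small gd); rewrite expr2 {1}/s mulr_suml.
rewrite [leRHS](bigID (same_on x r)) /=; apply: ler_wpDr.
  apply: sumr_ge0 => r1 _; apply: sumr_ge0 => r2 _; apply: mulr_ge0; exact: spec_ge0.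
apply: ler_sum => r1 /andP[_ /same_onP r1r]; rewrite mulr_sumr.
rewrite le_eqVlt; apply/orP; left; apply/eqP; apply: eq_bigl => r2.
congr (_ && _); apply/same_onP/same_onP => h e; first by rewrite -r1r h.
by rewrite r1r h.
Qed.

(** The quotient of the two characters is a product of large ones. Being trivial at the points of
    index [ord0], it is trivial on the whole group by [gp_type]. *)
Lemma large_inj r r' : r \in large g -> r' \in large g -> same_on x r r' -> r = r'.
Proof.
move=> rT rT' /same_onP rr'; have [//|ne] := eqVneq r r'.
(* As chi r' y ^+ L = 1, the exponent L.-1 stands for the inverse. *)
pose c s := if s == r then 1%N else if s == r' then L.-1 else 0%N.
have cE y : char_prod c y = chi r y * (chi r' y)^*%R.
  rewrite /char_prod (bigD1 r) //= (bigD1 r') 1?eq_sym //= big1 => [|s /andP[/negPf e1 /negPf e2]].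
    rewrite /c eqxx expr1 eq_sym (negPf ne) eqxx mulr1; congr (_ * _).
    apply: (mulfI (chi_neq0 sd r' y)); rewrite -exprS prednK ?(sd_gt0 sd) //.
    by rewrite (chi_conj sd) divff ?(chi_neq0 sd) // (sd_unity sd).
  by rewrite /c e1 e2.
apply: chi_inj => y; apply: divr1_eq; rewrite -(chi_conj sd) -cE.
apply: (gp_type gd (d := ord0)) => [s|j|]; last exact: expg0.
  rewrite /c; case: eqP => [->|_]; first by rewrite rT.
  by case: eqP => [->|//]; rewrite rT'.
by rewrite cE rr' (chi_conj sd) divff ?(chi_neq0 sd).
Qed.

Lemma bucket_large r : 0 <= gam -> r \in large g ->
  spec chi g r <= bucket g x r <= spec chi g r + gam ^+ 2.
Proof.
move=> g0 rT; rewrite /bucket (bigID (mem (large g))) /= (big_pred1 r) => [|r'].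
  rewrite lerDl sumr_ge0 ?lerD2l => [|r' _]; last exact: spec_ge0.
  by under eq_bigl do rewrite andbC; apply: bucket_small.
apply/andP/eqP => [[rr' r'T]|->]; last by split=> //; apply/same_onP.
exact/esym/large_inj.
Qed.

End Good.

Hypothesis gam_gt0 : 0 < gam.
Hypothesis delta_le : delta <= 9 * gam ^+ 2.

(** One statistic estimates both buckets within [gam ^+ 2], so they differ by at most
    [2 * gam ^+ 2]. The bucket for [g'] has mass at least [7 * gam ^+ 2], too much for small
    characters alone; small mass adds a last [gam ^+ 2] to the error. *)
Lemma heavy_match g g' x w r :
  good_points g x -> good_points g' x -> good_shifts g x w -> good_shifts g' x w ->
  agree g g' x w -> 9 * gam ^+ 2 <= spec chi g r ->
  exists2 r', (r' \in large g') && same_on x r r' &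
    `|spec chi g r - spec chi g' r'| <= 3 * gam ^+ 2.
Proof.
move=> gg gg' sg sg' ag hr.
have g0 := ltW gam_gt0; have gam2 : 0 < gam ^+ 2 by rewrite exprn_gt0.
have rT : r \in large g by rewrite inE (le_trans delta_le).
have /andP[b1 b2] := bucket_large gg g0 rT.
have := sg r; have := sg' r.
under [X in _ * X - bucket g x r]eq_bigr do rewrite (eq_correlation _ _ ag).
rewrite !ler_norml => /andP[c1 c2] /andP[d1 d2].
have [r' /andP[r'T rr']|none] := pickP (fun r' => (r' \in large g') && same_on x r r').
  exists r'; first by rewrite r'T.
  have bE : bucket g' x r = bucket g' x r'.
    apply: eq_bigl => s; apply/same_onP/same_onP => h e.
      by rewrite -h; apply/esym; move/same_onP: rr'.
    by rewrite -h; move/same_onP: rr'.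
  have /andP[e1 e2] := bucket_large gg' g0 r'T.
  by rewrite ler_norml; rewrite bE in c1 c2; lra.
have : bucket g' x r <= gam ^+ 2.
  rewrite /bucket -[leRHS]add0r (bigID (mem (large g'))) /=.
  rewrite big_pred0 => [|s]; last by rewrite andbC none.
  by rewrite add0r; under eq_bigl do rewrite andbC; rewrite add0r; apply: bucket_small.
by lra.
Qed.

(** Both coefficients are within [gam] of the same empirical mean. *)
Lemma hat_match g g' x w r r' :
  good_points g x -> good_points g' x -> agree g g' x w -> same_on x r r' ->
  9 * gam ^+ 2 <= spec chi g r -> 9 * gam ^+ 2 <= spec chi g' r' ->
  cabs (hat g r - hat g' r') <= 2 * gam.
Proof.
move=> gg gg' [ag _ _] /same_onP rr' hr hr'.
have := gp_coef gg' hr'; have := gp_coef gg hr.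
under eq_bigr do rewrite ag rr'.
set m := _ * _ => c c'; rewrite (_ : hat g r - hat g' r' = (m - hat g' r') - (m - hat g r)).
  by apply: le_trans (cabsB _ _) _; lra.
by ring.
Qed.

Lemma agree_sym g g' x w : agree g g' x w -> agree g' g x w.
Proof. by case=> h1 h2 h3; split=> j. Qed.

Lemma close_up_to_aut g g' x w :
  good_points g x -> good_points g' x -> good_shifts g x w -> good_shifts g' x w ->
  agree g g' x w ->
  exists2 s : {perm gT}, s \in Aut [set: gT] &
    forall r r', (forall y, chi r' (s y) = chi r y) ->
      cabs (hat g r - hat g' r') <= 10 * gam.
Proof.
move=> gg gg' sg sg' ag; have g0 := gam_gt0; have dle := delta_le.
have gam2 : 0 < gam ^+ 2 by rewrite exprn_gt0.
(* Matching loses [3 * gam ^+ 2], so a partner of a heavy character still has weight at least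
   [13 * gam ^+ 2], above the threshold 9 of [hat_match]. *)
pose heavy := [set r | 16 * gam ^+ 2 <= spec chi g r].
pose t r := odflt r [pick r' | (r' \in large g') && same_on x r r' &&
                               (`|spec chi g r - spec chi g' r'| <= 3 * gam ^+ 2)].
have tP r : r \in heavy -> [/\ t r \in large g', same_on x r (t r)
    & `|spec chi g r - spec chi g' (t r)| <= 3 * gam ^+ 2].
  rewrite inE => hr; rewrite /t; case: pickP => [r' /andP[/andP[h1 h2] h3]//|none].
  have hr9 : 9 * gam ^+ 2 <= spec chi g r by lra.
  have [r' h1 h2] := heavy_match gg gg' sg sg' ag hr9.
  by have := none r'; rewrite h1 h2.
have heavy_large r : r \in heavy -> r \in large g.
  by rewrite !inE; lra.
pose a r y := if r \in heavy then chi r y else 1.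
pose b r y := if r \in heavy then chi (t r) y else 1.
pose ca (c : {ffun gT -> 'I_L}) r : nat := if r \in heavy then nat_of_ord (c r) else 0%N.
(* Exponents with the same image under [t] are added up, which avoids proving [t] injective. *)
pose cb (c : {ffun gT -> 'I_L}) s := (\sum_(r in heavy | t r == s) c r)%N.
have aE c y : char_comb a c y = char_prod (ca c) y.
  by apply: eq_bigr => r _; rewrite /a /ca; case: ifP; rewrite ?expr1n ?expr0.
have bE c y : char_comb b c y = char_prod (cb c) y.
  rewrite /char_comb (bigID (mem heavy)) /= [X in _ * X]big1 ?mulr1 => [|r /negPf rh]; last first.
    by rewrite /b rh expr1n.
  rewrite (partition_big t predT) //=; apply: eq_bigr => s _.
  rewrite -prodrXr; apply: eq_bigr => r /andP[rh /eqP <-].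
  by rewrite /b rh.
have abE c e : char_comb a c (x e) = char_comb b c (x e).
  apply: eq_bigr => r _; rewrite /a /b; case: ifP => // rh.
  by have [_ /same_onP -> _] := tP r rh.
(* A relation valid on the [d]-torsion holds at the sampled [d]-torsion points, where matched
   characters agree, so it transfers there to the other family; [gp_type] then extends it to the
   whole [d]-torsion. *)
have ann_ab d (c : {ffun gT -> 'I_L}) : (d %| L)%N -> annihilates a d c = annihilates b d c.
  move=> dL; have dlt : (d < L.+1)%N by rewrite ltnS dvdn_leq ?(sd_gt0 sd).
  have xd j : (x (Ordinal dlt, j) ^+ d == 1)%g by rewrite (gp_torsion gg).
  apply/forallP/forallP => h y; apply/implyP => /eqP yd; apply/eqP.
    rewrite bE; apply: (gp_type gg' (d := Ordinal dlt)) yd => [s sT|j].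
      by apply: big_pred0 => r; apply: contraNF sT => /andP[/tP[? _ _] /eqP <-].
    by rewrite -bE -abE; apply/eqP; apply: (implyP (h _)).
  rewrite aE; apply: (gp_type gg (d := Ordinal dlt)) yd => [s sT|j].
    by rewrite /ca; case: ifP => // /heavy_large sl; rewrite sl in sT.
  by rewrite -aE abE; apply/eqP; apply: (implyP (h _)).
have hom r y z : a r (y * z)%g = a r y * a r z.
  by rewrite /a; case: ifP; rewrite ?mulr1 // (sd_morph sd).
have homb r y z : b r (y * z)%g = b r y * b r z.
  by rewrite /b; case: ifP; rewrite ?mulr1 // (sd_morph sd).
have [s sA sE] : exists2 s : {perm gT}, s \in Aut [set: gT] & forall r y, b r (s y) = a r y.
  apply: aut_of_annihilators ann_ab => //; [exact: (sd_abelian sd)|exact: (sd_gt0 sd)| | |].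
  - by move=> r y; rewrite /a; case: ifP; rewrite ?expr1n // (sd_unity sd).
  - by move=> r y; rewrite /b; case: ifP; rewrite ?expr1n // (sd_unity sd).
  - exact: (sd_exponent sd).
exists s => // r r' rr'.
have [rh|rh] := boolP (r \in heavy).
  have r'E : r' = t r.
    apply: chi_inj => y; rewrite -(permKV s y) rr'.
    by have := sE r (s^-1%g y); rewrite /a /b rh => ->.
  have [_ h2 h3] := tP r rh; move: rh; rewrite inE => rh.
  apply: (@le_trans _ _ (2 * gam)); last lra.
  rewrite r'E; apply: (hat_match gg gg' ag h2); first lra.
  by move: h3; rewrite ler_norml => /andP[? ?]; lra.
(* Otherwise [r'] is matched back to some [r2] of weight at least [33 * gam ^+ 2], which is heavy
   with [t r2 = r']; then [r = r2], although [r] is not heavy. The two light coefficients thus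
   contribute less than [4 * gam] and [6 * gam]. *)
have small : spec chi g' r' < 36 * gam ^+ 2.
  rewrite ltNge; apply/negP => hr'.
  have hr9 : 9 * gam ^+ 2 <= spec chi g' r' by lra.
  have [r2 /andP[r2T r'r2] d2] := heavy_match gg' gg sg' sg (agree_sym ag) hr9.
  have r2h : r2 \in heavy.
    by rewrite inE; move: d2; rewrite ler_norml => /andP[? ?]; lra.
  have [tT tsame _] := tP r2 r2h.
  have tr2 : t r2 = r'.
    apply: (large_inj gg') => //; first by rewrite inE; lra.
    by apply/same_onP => e; move/same_onP: tsame => <-; move/same_onP: r'r2 => ->.
  case/negP: rh; suff -> : r = r2 by [].
  by apply: chi_inj => y; rewrite -rr' -tr2; have := sE r2 y; rewrite /a /b r2h.
have c1 : cabs (hat g r) < 4 * gam.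
  rewrite inE -ltNge in rh; rewrite -(@ltr_pXn2r _ 2) ?nnegrE ?cabs_ge0 //; last lra.
  by rewrite exprMn; apply: lt_le_trans rh _; lra.
have c2 : cabs (hat g' r') < 6 * gam.
  rewrite -(@ltr_pXn2r _ 2) ?nnegrE ?cabs_ge0 //; last lra.
  by rewrite exprMn; apply: lt_le_trans small _; lra.
by apply: le_trans (cabsB _ _) _; lra.
Qed.

End Samples.

(** * Probability of a good sample *)

Lemma card_bigcup_le (I T : finType) (P : pred I) (B : I -> {set T}) :
  (#|\bigcup_(i | P i) B i| <= \sum_(i | P i) #|B i|)%N.
Proof.
elim/big_rec2: _ => [|i n A _ le]; first by rewrite cards0.
by apply: leq_trans (leq_card_setU _ _) _; rewrite leq_add2l.
Qed.

Section GoodSamples.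
Variables (R : realType) (gT : finGroupType) (L : nat) (chi : gT -> gT -> R[i]).
Hypothesis sd : self_dual L chi.
Variables (M : nat) (gam delta : R) (g : gT -> R[i]).
Hypothesis gJ : forall y, (g y)^*%R = g y.
Hypothesis g2 : forall y, g y * g y = 1.

Local Notation D := ('I_L.+1 * 'I_M)%type.
Local Notation coefs := {ffun D -> 'I_L}.
Local Notation spec := (spec chi g).
Local Notation large := (large chi delta g).

Definition torsion (d : nat) : {set gT} := [set y | (y ^+ d == 1)%g].

Definition point_samples : {set {ffun D -> gT}} :=
  [set x | x \in family (fun e : D => mem (torsion e.1))].

(** Parseval, read off the autocorrelation at the identity. *)
Lemma sum_spec : \sum_r spec r = 1.
Proof.
have := autocorrelation sd gJ 1%g.
under eq_bigr do rewrite mulg1 g2.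
under [X in _ = _ * X]eq_bigr do rewrite (chi_1 sd) mulr1.
rewrite sumr_const -[LHS]mulr1 -rmorph_sum => /(mulfI (card_gT_neq0 _ _)) /esym.
exact: complexI.
Qed.

Lemma cabs_g y : cabs (g y) = 1.
Proof.
have := congr1 (@cabs R) (g2 y); rewrite cabsM cabs1 -expr2 => /eqP.
by rewrite sqrp_eq1 ?cabs_ge0 // => /eqP.
Qed.

Lemma card_large : #|large|%:R * delta <= 1.
Proof.
rewrite -[leRHS]sum_spec (bigID (mem large)) /= mulr_natl -sumr_const.
apply: ler_wpDr; first by apply: sumr_ge0 => r _; apply: spec_ge0.
by apply: ler_sum => r; rewrite inE.
Qed.

Lemma sum_spec_not_large : \sum_(r | r \notin large) spec r <= 1.
Proof.
rewrite -[leRHS]sum_spec [leRHS](bigID (mem large)) /= lerDr sumr_ge0 // => r _.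
exact: spec_ge0.
Qed.

(** Translation by [y0] injects the torsion points with [u y = 1] into those with [u y != 1]. *)
Lemma card_torsion_half (u : gT -> R[i]) (d : nat) (y0 : gT) :
  (forall x y, u (x * y)%g = u x * u y) -> (y0 ^+ d = 1)%g -> u y0 != 1 ->
  (#|[set y in torsion d | u y == 1%R]| * 2 <= #|torsion d|)%N.
Proof.
move=> uM y0d uy0.
rewrite -(cardsID [set y | u y == 1] (torsion d)) -setIdE muln2 -addnn leq_add2l.
rewrite -(card_imset _ (mulIg y0)); apply/subset_leq_card/fintype.subsetP => _ /imsetP[y + ->].
rewrite !inE => /andP[yd /eqP uy]; rewrite uM uy mul1r uy0.
by rewrite (torsion_mul (sd_abelian sd)).
Qed.

Lemma char_prodM c x y :
  char_prod chi c (x * y)%g = char_prod chi c x * char_prod chi c y.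
Proof. by rewrite -big_split; apply: eq_bigr => r _; rewrite (sd_morph sd) exprMn. Qed.

Definition o0 : 'I_L := Ordinal (sd_gt0 sd).

Definition bad_type (d : 'I_L.+1) (c : {ffun gT -> 'I_L}) : {set {ffun D -> gT}} :=
  [set x in point_samples | [exists y in torsion d, char_prod chi (fun r => c r) y != 1] &&
     [forall j, char_prod chi (fun r => c r) (x (d, j)) == 1]].

Lemma card_bad_type d c : (#|bad_type d c| * 2 ^ M <= #|point_samples|)%N.
Proof.
have [/existsP[y0 /andP[]]|none] := boolP [exists y in torsion d, char_prod chi (fun r => c r) y != 1]; last first.
  rewrite (_ : bad_type d c = finset.set0) ?cards0 //; apply/setP=> x.
  by rewrite !inE (negPf none) andbF.
rewrite inE => /eqP y0d uy0.
pose J := [set (d, j) | j : 'I_M].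
have cJ : #|J| = M by rewrite card_imset ?card_ord // => j j' [].
have half (e : D) : e \in J ->
    (#|[set y in torsion e.1 | char_prod chi (fun r => c r) y == 1%R]| * 2 <= #|torsion e.1|)%N.
  by case/imsetP=> j _ ->; apply: card_torsion_half y0d uy0; apply: char_prodM.
have := card_family_forall half; rewrite cJ -[X in (_ <= X)%N]cardsE; apply: leq_trans.
rewrite leq_mul2r; apply/orP; right; apply/subset_leq_card/fintype.subsetP => x.
rewrite !inE => /and3P[-> _ /forallP h]; apply/forall_inP => _ /imsetP[j _ ->].
exact: h.
Qed.

(** The union runs over exponent vectors that vanish off the large characters, [o0] being the zero
    exponent; there are only [L ^ #|large|] of them. *)
Definition bad_types : {set {ffun D -> gT}} :=
  \bigcup_(dc : 'I_L.+1 * {ffun gT -> 'I_L} | dc.2 \in pffun_on o0 (mem large) predT)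
     bad_type dc.1 dc.2.

Lemma card_bad_types :
  (#|bad_types| * 2 ^ M <= L.+1 * L ^ #|large| * #|point_samples|)%N.
Proof.
apply: leq_trans (_ : (\sum_(dc : 'I_L.+1 * {ffun gT -> 'I_L} |
   dc.2 \in pffun_on o0 (mem large) predT) #|bad_type dc.1 dc.2|) * 2 ^ M <= _)%N.
  by rewrite leq_mul2r card_bigcup_le orbT.
rewrite big_distrl /=.
apply: leq_trans (leq_sum _ (fun dc _ => card_bad_type dc.1 dc.2)) _.
rewrite sum_nat_const leq_mul2r; apply/orP; right.
have <- : #|[predX (@predT 'I_L.+1) & pffun_on o0 (mem large) (@predT 'I_L)]| =
    (L.+1 * L ^ #|large|)%N.
  by rewrite cardX card_pffun_on !cardT !size_enum_ord.
by apply/subset_leq_card/fintype.subsetP => -[d c]; rewrite !inE.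
Qed.

(** Characters have order dividing [L], so arbitrary exponents may be reduced modulo [L] to one of
    the finitely many vectors in [bad_types]. *)
Lemma good_type x : x \in point_samples -> x \notin bad_types ->
  forall (d : 'I_L.+1) (c : gT -> nat),
    (forall r, r \notin large -> c r = 0%N) ->
    (forall j, char_prod chi c (x (d, j)) = 1) ->
    forall y : gT, (y ^+ d = 1)%g -> char_prod chi c y = 1.
Proof.
move=> xP xB d c cl cx y yd; apply/eqP; apply: contraNT xB => cy.
pose c' : {ffun gT -> 'I_L} := [ffun r => Ordinal (ltn_pmod (c r) (sd_gt0 sd))].
have cE z : char_prod chi (fun r => c' r) z = char_prod chi c z.
  by apply: eq_bigr => r _; rewrite ffunE /= expr_mod // (sd_unity sd).
apply/bigcupP; exists (d, c') => /=.
  apply/pffun_onP; split=> [|r _]; last by [].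
  apply/supportP => r rT; apply/val_inj; rewrite ffunE /= cl ?mod0n //.
rewrite inE xP /=; apply/andP; split; last by apply/forallP=> j; rewrite cE cx.
by apply/existsP; exists y; rewrite inE yd eqxx cE cy.
Qed.

Lemma card_same_on r r' : r != r' ->
  (#|[set x in point_samples | same_on chi x r r']| * 2 ^ M <= #|point_samples|)%N.
Proof.
move=> ne; pose u y := chi r y * (chi r' y)^*%R.
have uM y z : u (y * z)%g = u y * u z by rewrite /u !(sd_morph sd) rmorphM mulrACA.
have [y0 uy0] : exists y, u y != 1.
  apply/existsP; apply: contraNT ne => /existsPn h; apply/eqP/(chi_inj sd) => y.
  by apply: divr1_eq; rewrite -(chi_conj sd); apply/eqP; rewrite -[_ == _]negbK h.
pose J := [set (ord0 : 'I_L.+1, j) | j : 'I_M].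
have cJ : #|J| = M by rewrite card_imset ?card_ord // => j j' [].
have half (e : D) : e \in J ->
    (#|[set y in torsion e.1 | u y == 1%R]| * 2 <= #|torsion e.1|)%N.
  by case/imsetP=> j _ ->; apply: card_torsion_half uy0 => //; apply: expg0.
have := card_family_forall half; rewrite cJ -[X in (_ <= X)%N]cardsE; apply: leq_trans.
rewrite leq_mul2r; apply/orP; right; apply/subset_leq_card/fintype.subsetP => x.
rewrite !inE => /andP[-> /forallP h]; apply/forall_inP => _ /imsetP[j _ ->].
by rewrite /u (eqP (h _)) (chi_conj sd) divff ?(chi_neq0 sd).
Qed.

Definition small_pairs (x : {ffun D -> gT}) : R :=
  \sum_(r | r \notin large)
    \sum_(r' | (r' \notin large) && same_on chi x r r') spec r * spec r'.

Lemma small_pairs_ge0 x : 0 <= small_pairs x.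
Proof. by apply: sumr_ge0 => r _; apply: sumr_ge0 => r' _; apply: mulr_ge0; apply: spec_ge0. Qed.

(** Diagonal pairs contribute at most [delta] on average, since small weights are below [delta] and
    sum to at most 1; distinct characters collide with probability at most [2 ^- M]. *)
Lemma sum_small_pairs : 0 <= delta ->
  \sum_(x in point_samples) small_pairs x <= #|point_samples|%:R * (delta + (2 ^+ M)^-1).
Proof.
move=> d0; pose N : R := #|point_samples|%:R.
have two_gt0 : 0 < 2 ^+ M :> R by rewrite exprn_gt0.
have count r r' : \sum_(x in point_samples) (same_on chi x r r')%:R <=
    N * ((r == r')%:R + (2 ^+ M)^-1).
  have -> : \sum_(x in point_samples) (same_on chi x r r')%:R =
      #|[set x in point_samples | same_on chi x r r']|%:R :> R.
    rewrite cardsE -sum1_card natr_sum big_mkcondr.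
    by apply: eq_bigr => x _; case: ifP.
  have [_|ne] := eqVneq r r'.
    rewrite mulrDr mulr1; apply: ler_wpDr; first by rewrite mulr_ge0 ?invr_ge0 // ltW.
    by rewrite ler_nat; apply/subset_leq_card/fintype.subsetP => x; rewrite inE => /andP[].
  by rewrite add0r ler_pdivlMr // -natrX -natrM ler_nat card_same_on.
apply: (@le_trans _ _ (\sum_(r | r \notin large) \sum_(r' | r' \notin large)
    spec r * spec r' * (N * ((r == r')%:R + (2 ^+ M)^-1)))).
  rewrite exchange_big /=; apply: ler_sum => r _.
  under eq_bigr do rewrite big_mkcondr /=.
  rewrite exchange_big /=; apply: ler_sum => r' _.
  apply: le_trans (ler_wpM2l _ (count r r')); last by apply: mulr_ge0; apply: spec_ge0.
  by rewrite mulr_sumr; apply: ler_sum => x _; case: ifP; rewrite ?mulr1 ?mulr0.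
have part r : r \notin large -> \sum_(r' | r' \notin large)
    spec r * spec r' * (N * ((r == r')%:R + (2 ^+ M)^-1)) <= spec r * (N * (delta + (2 ^+ M)^-1)).
  move=> rT; under eq_bigr do rewrite -mulrA.
  rewrite -mulr_sumr ler_wpM2l ?spec_ge0 //.
  under eq_bigr do rewrite mulrCA mulrDr.
  rewrite -mulr_sumr ler_wpM2l ?ler0n // big_split /= lerD //.
    rewrite (bigD1 r) //= eqxx mulr1 big1 ?addr0 => [|r' /andP[_ /negPf ne]].
      by rewrite ltW // ltNge; move: rT; rewrite inE.
    by rewrite eq_sym ne mulr0.
  by rewrite -mulr_suml ler_piMl ?invr_ge0 ?sum_spec_not_large // ltW.
apply: le_trans (ler_sum _ part) _; rewrite -mulr_suml ler_piMl ?sum_spec_not_large //.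
by rewrite mulr_ge0 ?ler0n // addr_ge0 // invr_ge0 ltW.
Qed.

Definition deviation (r y : gT) : R[i] := g y * (chi r y)^*%R - hat chi g r.

Lemma cabs_hat r : cabs (hat chi g r) <= 1.
Proof.
rewrite -(@ler_pXn2r _ 2) ?nnegrE ?cabs_ge0 ?ler01 // expr1n -[leRHS]sum_spec.
by rewrite (bigD1 r) //= lerDl sumr_ge0 // => r' _; apply: spec_ge0.
Qed.

Lemma cabs_deviation r y : cabs (deviation r y) <= 2.
Proof.
apply: le_trans (cabsB _ _) _; rewrite cabsM cabs_g cabs_conj (cabs_chi sd) mulr1.
by have := cabs_hat r; lra.
Qed.

Lemma sum_deviation r : \sum_y deviation r y = 0.
Proof.
rewrite big_split /= sumr_const cardT -cardE mulNrn -[_ *+ _]mulr_natl /hat /fourier.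
by rewrite mulVKf ?subrr // card_gT_neq0.
Qed.

(** Distinct coordinates are independent and centred, so the cross terms cancel and only [M] squares
    of size at most 4 remain. *)
Lemma sum_sqr_deviation r :
  \sum_(x in point_samples) cabs (\sum_j deviation r (x (ord0, j))) ^+ 2
    <= #|point_samples|%:R * (4 * M%:R).
Proof.
have -> : \sum_(x in point_samples) cabs (\sum_j deviation r (x (ord0, j))) ^+ 2 =
    \sum_(x in point_samples) \sum_j cabs (deviation r (x (ord0, j))) ^+ 2.
  apply: complexI; rewrite !rmorph_sum /=.
  under eq_bigr do rewrite -mul_conj_cabs rmorph_sum mulr_suml.
  under [RHS]eq_bigr do rewrite rmorph_sum.
  rewrite exchange_big [RHS]exchange_big /=; apply: eq_bigr => j _.
  under eq_bigr do rewrite mulr_sumr.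
  rewrite exchange_big (bigD1 j) //= [X in _ + X]big1 ?addr0 => [|j' ne].
    by apply: eq_bigr => x _; rewrite mul_conj_cabs.
  rewrite (eq_bigl (mem (family (fun e : D => mem (torsion e.1))))) => [|x]; last by rewrite inE.
  apply: (sum_family_uncorrelated (fun y => (deviation r y)^*%R)).
    by apply: contra ne => /eqP[->].
  by rewrite -[RHS](sum_deviation r); apply: eq_bigl => y; rewrite inE expg0 eqxx.
rewrite -sumr_const mulr_suml; apply: ler_sum => x _; rewrite mul1r.
apply: (@le_trans _ _ (\sum_(j < M) 4)); last by rewrite sumr_const card_ord mulr_natr.
apply: ler_sum => j _; rewrite (_ : 4 = 2 ^+ 2) ?lerXn2r ?nnegrE ?cabs_ge0 ?cabs_deviation //.
by rewrite -natrX.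
Qed.

Definition bad_coef (r : gT) : {set {ffun D -> gT}} :=
  [set x in point_samples |
    (M%:R * gam) ^+ 2 <= cabs (\sum_j deviation r (x (ord0, j))) ^+ 2].

(** Chebyshev: Markov applied to the second moment. *)
Lemma card_bad_coef r : (0 < M)%N -> 0 < gam ->
  #|bad_coef r|%:R * (M%:R * gam ^+ 2) <= #|point_samples|%:R * 4.
Proof.
move=> M0 g0; have MR : 0 < M%:R :> R by rewrite ltr0n.
have t0 : 0 < (M%:R * gam) ^+ 2 by rewrite exprn_gt0 // mulr_gt0.
have f0 (x : {ffun D -> gT}) : 0 <= cabs (\sum_j deviation r (x (ord0, j))) ^+ 2 by apply: sqr_ge0.
have := le_trans (markov_card point_samples t0 f0) (sum_sqr_deviation r).
move=> le; rewrite -(ler_pM2r MR) -[leRHS]mulrA.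
rewrite (_ : _ * M%:R = #|bad_coef r|%:R * (M%:R * gam) ^+ 2) //; ring.
Qed.

End GoodSamples.

(** * Estimating the mass of every class from random shifts *)

Section GoodShifts.
Variables (R : realType) (gT : finGroupType) (L : nat) (chi : gT -> gT -> R[i]).
Hypothesis sd : self_dual L chi.
Variables (M S : nat) (g : gT -> R[i]).
Hypothesis gJ : forall y, (g y)^*%R = g y.
Hypothesis g2 : forall y, g y * g y = 1.

Local Notation D := ('I_L.+1 * 'I_M)%type.
Local Notation coefs := {ffun D -> 'I_L}.
Local Notation spec := (spec chi g).
Variable x : {ffun D -> gT}.

Lemma chi_word r (k : coefs) : chi r (subset_word x k) = \prod_e chi r (x e) ^+ k e.
Proof.
rewrite /subset_word (big_morph (chi r) (sd_morph sd r) (chi_1 sd r)).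
apply: eq_bigr => e _; elim: (nat_of_ord (k e)) => [|n IHn].
  by rewrite expg0 (chi_1 sd).
by rewrite expgS (sd_morph sd) IHn exprS.
Qed.

(** The sum splits into one geometric sum per sampled point, which vanishes wherever the two
    characters differ. *)
Lemma sum_word r r' :
  \sum_(k : coefs) chi r' (subset_word x k) * (chi r (subset_word x k))^*%R =
  if same_on chi x r r' then #|{: coefs}|%:R else 0.
Proof.
pose z e := chi r' (x e) * (chi r (x e))^*%R.
transitivity (\prod_e \sum_(c < L) z e ^+ c).
  rewrite bigA_distr_bigA; apply: eq_bigr => k _.
  rewrite !chi_word rmorph_prod -big_split /=; apply: eq_bigr => e _.
  by rewrite rmorphXn exprMn.
have zL e : z e ^+ L = 1.
  by rewrite exprMn -rmorphXn !(sd_unity sd) rmorph1 mulr1.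
have z1 e : (z e == 1) = (chi r (x e) == chi r' (x e)).
  rewrite /z (chi_conj sd); apply/eqP/eqP => [/divr1_eq->//|->].
  by rewrite divff ?(chi_neq0 sd).
have [/same_onP same|/forallPn[e ne]] := ifPn.
  rewrite card_ffun card_ord natrX -prodr_const; apply: eq_bigr => e _.
  by rewrite sum_expr_root1 // z1 same eqxx.
by rewrite (bigD1 e) //= sum_expr_root1 // z1 (negPf ne) mul0r.
Qed.

Lemma Re_sum (I : finType) (F : I -> R[i]) :
  complex.Re (\sum_i F i) = \sum_i complex.Re (F i).
Proof. by apply: big_morph => // -[a b] [c d]. Qed.

(** Averaging over the base point gives the autocorrelation at the word; averaging over words then
    keeps exactly the characters in the class of [r]. *)
Lemma sum_correlation r :
  \sum_ck correlation chi g x r ck = #|{: gT * coefs}|%:R * bucket chi g x r.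
Proof.
rewrite -Re_sum.
rewrite (_ : \sum_ck _ = (#|{: gT * coefs}|%:R * bucket chi g x r)%:C%C) //.
transitivity (\sum_(k : coefs) \sum_c g c * g (c * subset_word x k)%g *
    (chi r (subset_word x k))^*%R).
  by rewrite exchange_big pair_big.
under eq_bigr do rewrite -mulr_suml (autocorrelation sd gJ) -mulrA.
rewrite -mulr_sumr card_prod natrM -mulrA rmorphM /= rmorph_nat; congr (_ * _).
under eq_bigr do rewrite mulr_suml.
rewrite exchange_big rmorphM /= rmorph_nat /bucket rmorph_sum /= mulr_sumr.
rewrite [RHS]big_mkcond; apply: eq_bigr => r' _.
under eq_bigr do rewrite -mulrA.
by rewrite -mulr_sumr sum_word; case: ifP; rewrite ?mulr0 // mulrC.
Qed.

Lemma correlation_le1 r ck : `|correlation chi g x r ck| <= 1.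
Proof.
apply: le_trans (normr_Re_le _) _.
by rewrite !cabsM !(cabs_g g2) cabs_conj (cabs_chi sd) !mulr1.
Qed.

Lemma bucket_le1 r : 0 <= bucket chi g x r <= 1.
Proof.
rewrite sumr_ge0 => [|r' _]; last exact: spec_ge0.
rewrite -[leRHS](sum_spec sd gJ g2) [leRHS](bigID (same_on chi x r)) /= lerDl sumr_ge0 // => r' _.
exact: spec_ge0.
Qed.

Definition bad_shift (eta : R) (r : gT) : {set {ffun 'I_S -> gT * coefs}} :=
  [set w : {ffun 'I_S -> gT * coefs} | eta < `|S%:R^-1 * (\sum_j correlation chi g x r (w j)) - bucket chi g x r|].

(** The upper tail bound is applied to the correlation and to its negative. *)
Lemma card_bad_shift eta r : (0 < S)%N -> 0 < eta <= 1 ->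
  #|bad_shift eta r|%:R <=
    2 * expR (- (S%:R * eta ^+ 2 / 32)) * #|{: {ffun 'I_S -> gT * coefs}}|%:R.
Proof.
move=> S0 eta01; have SR : 0 < S%:R :> R by rewrite ltr0n.
have /andP[b0 b1] := bucket_le1 r.
have V1 ck : `|- correlation chi g x r ck| <= 1 by rewrite normrN correlation_le1.
have mean : \sum_ck - correlation chi g x r ck = #|{: gT * coefs}|%:R * - bucket chi g x r.
  by rewrite sumrN sum_correlation mulrN.
have m1 : `|bucket chi g x r| <= 1 by rewrite ger0_norm.
have m1' : `|- bucket chi g x r| <= 1 by rewrite normrN.
have up := hoeffding_upper S (correlation_le1 r) (sum_correlation r) m1 eta01.
have lo := hoeffding_upper S V1 mean m1' eta01.
rewrite card_ffun card_ord natrX -mulrA mulr_natl mulr2n.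
apply: le_trans (lerD up lo); rewrite -natrD ler_nat.
apply: leq_trans (leq_card_setU _ _); apply/subset_leq_card/fintype.subsetP => w.
rewrite !inE sumrN; set s := \sum_j _; rewrite ltr_normr => /orP[] h; apply/orP.
  left; rewrite -ler_pdivlMl //; lra.
right; rewrite -ler_pdivlMl // mulrN; lra.
Qed.

Definition char_values : seq R[i] := undup [seq chi rx.1 rx.2 | rx : gT * gT].

Lemma size_char_values : (size char_values <= L)%N.
Proof.
apply: max_unity_roots (sd_gt0 sd) _ (undup_uniq _).
apply/allP => z; rewrite mem_undup => /mapP[rx _ ->].
by rewrite unity_rootE (sd_unity sd).
Qed.

(** Codes the restriction of a character to the sample. The indices are below [L] because there are
    at most [L] values, so the default [o0] of [insubd] never occurs. *)
Definition pattern (r : gT) : coefs :=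
  [ffun e => insubd (o0 sd) (index (chi r (x e)) char_values)].

Lemma pattern_same r r' : pattern r = pattern r' -> same_on chi x r r'.
Proof.
move=> /ffunP h; apply/same_onP => e.
have val_in s : chi s (x e) \in char_values.
  by rewrite mem_undup; apply/mapP; exists (s, x e); rewrite ?mem_enum.
have lt s : (index (chi s (x e)) char_values < L)%N.
  by apply: leq_trans size_char_values; rewrite index_mem.
have := congr1 val (h e); rewrite !ffunE !val_insubd !lt => eqi.
by rewrite -(nth_index 0 (val_in r)) eqi nth_index.
Qed.

Lemma same_on_stat r r' : same_on chi x r r' ->
  (forall ck, correlation chi g x r ck = correlation chi g x r' ck) /\
  bucket chi g x r = bucket chi g x r'.
Proof.
move=> /same_onP same; split=> [ck|].
  by rewrite /correlation !chi_word; under eq_bigr do rewrite same.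
by apply: eq_bigl => s; apply/same_onP/same_onP => h e; rewrite -h same.
Qed.

Definition bad_shifts (eta : R) : {set {ffun 'I_S -> gT * coefs}} :=
  \bigcup_r bad_shift eta r.

(** The union bound takes one representative per pattern, not every character, which makes the
    factor independent of the order of the group. *)
Lemma card_bad_shifts eta : (0 < S)%N -> 0 < eta <= 1 ->
  #|bad_shifts eta|%:R <= (L ^ (L.+1 * M))%:R *
    (2 * expR (- (S%:R * eta ^+ 2 / 32))) * #|{: {ffun 'I_S -> gT * coefs}}|%:R.
Proof.
move=> S0 eta01; pose rep (u : coefs) := odflt 1%g [pick r | pattern r == u].
have sub : bad_shifts eta \subset \bigcup_(u : coefs) bad_shift eta (rep u).
  apply/bigcupsP => r _; apply: fintype.subset_trans (finset.bigcup_sup (pattern r) _) => //.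
  apply/fintype.subsetP => w; rewrite !inE.
  have [h1 h2] : (forall ck, correlation chi g x r ck = correlation chi g x (rep (pattern r)) ck) /\
      bucket chi g x r = bucket chi g x (rep (pattern r)).
    apply: same_on_stat; apply: pattern_same; rewrite /rep.
    by case: pickP => [r' /eqP->//|/(_ r)]; rewrite eqxx.
  by under eq_bigr do rewrite h1; rewrite h2.
apply: (@le_trans _ _ (\sum_(u : coefs) #|bad_shift eta (rep u)|%:R)).
  rewrite -natr_sum ler_nat; apply: leq_trans (subset_leq_card sub) _.
  exact: card_bigcup_le.
apply: le_trans (ler_sum _ (fun u _ => card_bad_shift (rep u) S0 eta01)) _.
rewrite sumr_const -[leLHS]mulr_natl -[leRHS]mulrA.
have <- : #|{: coefs}| = (L ^ (L.+1 * M))%N by rewrite card_ffun card_prod !card_ord.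
by [].
Qed.

Lemma good_shiftsP eta (w : {ffun 'I_S -> gT * coefs}) : w \notin bad_shifts eta ->
  forall r, `|S%:R^-1 * (\sum_j correlation chi g x r (w j)) - bucket chi g x r| <= eta.
Proof.
move=> wB r; rewrite leNgt; apply: contra wB => h.
by apply/bigcupP; exists r => //; rewrite inE.
Qed.

End GoodShifts.

(** * The tester *)

Section Distance.
Variables (R : realType) (gT : finGroupType) (L : nat) (chi : gT -> gT -> R[i]).
Hypothesis sd : self_dual L chi.
Implicit Types A B : {set gT}.

Lemma conj_sign_ind A x : (sign_ind R A x)^*%R = sign_ind R A x.
Proof. by rewrite /sign_ind; case: ifP; rewrite ?rmorphN rmorph1. Qed.

Lemma sqr_sign_ind A x : sign_ind R A x * sign_ind R A x = 1.
Proof. by rewrite /sign_ind; case: ifP; rewrite ?mulrNN mulr1. Qed.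

(** The product of the signs is -1 exactly on the symmetric difference. *)
Lemma sum_sign_ind A B :
  \sum_x sign_ind R A x * sign_ind R B x = (#|gT|%:R * (1 - 2 * dist R A B))%:C%C.
Proof.
have GN0 : #|gT|%:R != 0 :> R by rewrite pnatr_eq0 -lt0n; apply/card_gt0P; exists 1%g.
have -> : #|gT|%:R * (1 - 2 * dist R A B) = \sum_(x : gT) 1 - 2 * (#|A :\: B| + #|B :\: A|)%:R.
  rewrite sumr_const /dist mulrBr mulr1 mulrCA [X in _ - _ * X]mulrC divfK //.
rewrite natrD -!sum1_card !natr_sum mulrDr !mulr_sumr opprD addrA -!sumrN.
rewrite [X in _ + X + _]big_mkcond [X in _ + _ + X]big_mkcond -!big_split /= rmorph_sum.
apply: eq_bigr => x _; rewrite !inE /sign_ind.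
by case: (x \in A); case: (x \in B) => /=; rewrite ?mulrNN ?mulN1r ?mulrN1 ?mulr1 ?addr0 //;
  rewrite -rmorphN /= -?rmorphD /=; congr (_%:C%C); lra.
Qed.

Lemma parseval (f h : gT -> R[i]) :
  \sum_x f x * (h x)^*%R = #|gT|%:R * \sum_r hat chi f r * (hat chi h r)^*%R.
Proof.
under eq_bigr do rewrite [X in _ * X^*](fourier_inv sd h) rmorph_sum mulr_sumr.
rewrite exchange_big mulr_sumr; apply: eq_bigr => r _ /=.
transitivity ((\sum_x f x * (chi r x)^*%R) * (hat chi h r)^*%R).
  by rewrite mulr_suml; apply: eq_bigr => x _; rewrite rmorphM /hat /=; ring.
by rewrite mulrA; congr (_ * _); rewrite /hat /fourier mulVKf ?card_gT_neq0.
Qed.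

Lemma hat_imset B (t : {perm gT}) r r' : (forall y, chi r' y = chi r (t y)) ->
  hat chi (sign_ind R (t @: B)) r = hat chi (sign_ind R B) r'.
Proof.
move=> rr'; rewrite /hat /fourier (reindex_inj (@perm_inj _ t)); congr (_ * _).
apply: eq_bigr => x _; rewrite rr' /sign_ind mem_imset //; exact: perm_inj.
Qed.

Lemma dist_Aut_le A B (t : {perm gT}) : t \in Aut [set: gT] ->
  dist_Aut R A B <= dist R A (t @: B).
Proof. by move=> tA; apply: bigmin_le_cond. Qed.

Lemma dist_Aut_attained A B (eps : R) : dist_Aut R A B <= eps ->
  exists2 t : {perm gT}, t \in Aut [set: gT] & dist R A (t @: B) <= eps.
Proof.
rewrite /dist_Aut; elim/big_rec: _ => [le|t m tA IH].
  exists 1%g; first exact: group1.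
  by rewrite (_ : _ @: B = B) //; apply/setP=> x;
    rewrite -{1}[x](perm1 x) mem_imset //; apply: perm_inj.
by rewrite ge_min => /orP[le|/IH//]; exists t.
Qed.

(** By Parseval [1 - 2 * dist] is the correlation of Fourier coefficients. Composing with
    automorphisms permutes these, so an error of [10 * gam] in each costs [10 * gam] times the
    spectral norm of [A], and half of that in distance. *)
Lemma dist_transfer A B B' (gam : R) (s t : {perm gT}) :
  t \in Aut [set: gT] -> s \in Aut [set: gT] -> 0 <= gam ->
  (forall r r', (forall y, chi r' (s y) = chi r y) ->
     cabs (hat chi (sign_ind R B) r - hat chi (sign_ind R B') r') <= 10 * gam) ->
  dist R A ((s * t)%g @: B) <= dist R A (t @: B') +
    5 * gam * \sum_r cabs (hat chi (sign_ind R A) r).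
Proof.
move=> tA sA g0 close; set f := sign_ind R A.
have GR : 0 < #|gT|%:R :> R by rewrite ltr0n; apply/card_gt0P; exists 1%g.
have correl B1 : (1 - 2 * dist R A B1)%:C%C =
    \sum_r hat chi f r * (hat chi (sign_ind R B1) r)^*%R.
  apply: (mulfI (card_gT_neq0 R gT)); rewrite -parseval.
  under eq_bigr do rewrite conj_sign_ind.
  by rewrite sum_sign_ind rmorphM /= rmorph_nat.
have : cabs ((1 - 2 * dist R A (t @: B'))%:C%C - (1 - 2 * dist R A ((s * t)%g @: B))%:C%C)
    <= \sum_r cabs (hat chi f r) * (10 * gam).
  rewrite !correl -sumrB; apply: le_trans (cabs_sum _ _) _; apply: ler_sum => r _.
  rewrite -mulrBr cabsM ler_wpM2l ?cabs_ge0 // -rmorphB /= cabs_conj cabs_distC.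
  have [r1 h1] := chi_comp_aut sd r tA; have [r2 h2] := chi_comp_aut sd r1 sA.
  rewrite (hat_imset _ h1) (@hat_imset _ _ _ r2) => [|y]; last by rewrite h2 h1 permM.
  by apply: close => y; rewrite h2.
rewrite -[X in cabs X](rmorphB (real_complex R)) cabs_real -mulr_suml ler_norml => /andP[_].
set n := \sum_r _; lra.
Qed.

End Distance.

(** * Nonadaptive algorithms as query trees *)

Section QueryTrees.
Variables (R : realType) (gT : finGroupType).

Fixpoint ask_all (s : seq gT) (k : seq bool -> bool) : query_tree gT :=
  if s is y :: s' then
    Query y (ask_all s' (fun l => k (true :: l))) (ask_all s' (fun l => k (false :: l)))
  else Answer _ (k [::]).

Lemma run_ask_all s k (B : {set gT}) :
  run_tree (ask_all s k) B = k [seq y \in B | y <- s].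
Proof. by elim: s k => //= y s IHs k; case: ifP => yB; rewrite IHs. Qed.

Lemma num_queries_ask_all s k : num_queries (ask_all s k) = size s.
Proof. by elim: s k => //= y s IHs k; rewrite !IHs maxnn. Qed.

(** On a sample good for [B], a yes-instance explains its own answers, and [sound] forbids any good
    yes-instance from explaining those of a no-instance. The rule [dec] is thus correct whenever the
    sample is good. *)
Lemma solvable_by_sampling (A : {set gT}) (eps tau : R) (q : nat)
    (W : finType) (p : W -> R) (pts : W -> seq gT) (good : {set gT} -> W -> Prop) :
  (forall w, 0 <= p w) -> \sum_w p w = 1 -> (forall w, (size (pts w) <= q)%N) ->
  (forall B, 2 / 3 <= \sum_(w | `[< good B w >]) p w) ->
  (forall B B' w, good B w -> good B' w ->
     [seq y \in B | y <- pts w] = [seq y \in B' | y <- pts w] ->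
     dist_Aut R A B' <= eps -> dist_Aut R A B < eps + tau) ->
  solvable_with A eps tau q.
Proof.
move=> p0 p1 ptsq gd sound.
pose dec w (l : seq bool) : bool := `[< exists B', [/\ dist_Aut R A B' <= eps, good B' w
  & [seq y \in B' | y <- pts w] = l] >].
exists (RandAlg (fun w => ask_all (pts w) (dec w)) p0 p1); split.
  by move=> w /=; rewrite num_queries_ask_all.
have out B b : (forall w, good B w -> dec w [seq y \in B | y <- pts w] = b) ->
    2 / 3 <= prob_output (RandAlg (fun w => ask_all (pts w) (dec w)) p0 p1) B b.
  move=> decE; apply: le_trans (gd B) _; rewrite /prob_output /=.
  rewrite [leLHS]big_mkcond [leRHS]big_mkcond; apply: ler_sum => w _.
  rewrite run_ask_all; case: ifPn => [/asboolP gB|_]; last by case: ifP.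
  by rewrite decE // eqxx.
move=> B; split=> dB; apply: out => w gB.
  by apply/asboolP; exists B.
apply/asboolP => -[B' [dB' gB' eB]].
by have := sound _ _ _ gB gB' (esym eB) dB'; rewrite ltNge dB.
Qed.

End QueryTrees.

(** * Parameters, failure probabilities and correctness of the tester *)

Section Tester.
Variables (R : realType) (gT : finGroupType) (L : nat) (chi : gT -> gT -> R[i]).
Hypothesis sd : self_dual L chi.
Variables (K S : nat) (gam : R).
Hypothesis gam01 : 0 < gam <= 1.
(** The mean collision mass is then at most [2 * delta = gam ^+ 4 / 12], so Markov at level
    [gam ^+ 4] fails with probability at most 1/12. *)
Let delta := gam ^+ 4 / 24.
(** [2 ^ M] is 16 times [2 ^ L.+1 * (2 ^ L) ^ K], which dominates the number [L.+1 * L ^ K] of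
    possible bad types. *)
Let M := (5 + L + L * K)%N.
Hypothesis K_ge : 1 <= K%:R * delta.
Hypothesis S_ge : 32 * ((L * (L.+1 * M))%:R + 12) <= S%:R * gam ^+ 4.

Local Notation D := ('I_L.+1 * 'I_M)%type.
Local Notation coefs := {ffun D -> 'I_L}.
Local Notation points := (point_samples gT L M).

Let gam_gt0 : 0 < gam. Proof. by case/andP: gam01. Qed.
Let gam4_gt0 : 0 < gam ^+ 4. Proof. by rewrite exprn_gt0. Qed.
Let delta_gt0 : 0 < delta. Proof. by rewrite divr_gt0. Qed.

Lemma leK_M : (K <= M)%N.
Proof. by rewrite /M -{1}[K]mul1n (leq_trans (leq_mul (sd_gt0 sd) (leqnn K))) ?leq_addl. Qed.

Lemma M_ge : 24 <= M%:R * gam ^+ 4.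
Proof.
have h : 24 <= K%:R * gam ^+ 4 by move: K_ge; rewrite /delta; lra.
by apply: le_trans h _; rewrite ler_wpM2r ?ler_nat ?leK_M // ltW.
Qed.

Section OneFunction.
Variable g : gT -> R[i].
Hypothesis gJ : forall y, (g y)^*%R = g y.
Hypothesis g2 : forall y, g y * g y = 1.
Local Notation spec := (spec chi g).
Local Notation large := (large chi delta g).

Definition bad_small : {set {ffun D -> gT}} :=
  [set x in points | gam ^+ 4 <= small_pairs chi delta g x].

Definition bad_coefs : {set {ffun D -> gT}} :=
  \bigcup_(r | 9 * gam ^+ 2 <= spec r) bad_coef L chi M gam g r.

Definition bad_points : {set {ffun D -> gT}} :=
  bad_types sd M delta g :|: bad_small :|: bad_coefs.

Lemma card_bad_types_le : (#|bad_types sd M delta g| * 16 <= #|points|)%N.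
Proof.
have lK : (#|large| <= K)%N.
  rewrite -(ler_nat R) -(ler_pM2r delta_gt0).
  exact: le_trans (card_large sd delta gJ g2) K_ge.
have pos : (0 < L.+1 * L ^ K)%N by rewrite muln_gt0 expn_gt0 (sd_gt0 sd).
rewrite -(leq_pmul2l pos); apply: leq_trans (leq_trans (card_bad_types sd M delta g) _); last first.
  by rewrite leq_mul2r leq_mul2l leq_pexp2l ?(sd_gt0 sd) ?orbT.
rewrite mulnCA leq_mul2l; apply/orP; right.
have K0 : (0 < K)%N.
  by rewrite lt0n; apply: contraTneq K_ge => ->; rewrite mul0r -ltNge ltr01.
have -> : (2 ^ M = 2 ^ L.+1 * (2 ^ L) ^ K * 16)%N.
  by rewrite -expnM -expnD -[16%N]/(2 ^ 4)%N -expnD /M; congr (2 ^ _)%N; lia.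
rewrite leq_mul2r /= leq_mul // ?leq_exp2r // ltnW // ltn_expl //.
Qed.

Lemma card_bad_small_le : #|bad_small|%:R * 12 <= #|points|%:R :> R.
Proof.
have := markov_card points gam4_gt0 (small_pairs_ge0 chi delta g (M := M)).
move=> /le_trans/(_ (sum_small_pairs sd M gJ g2 (ltW delta_gt0))) h.
have pow : (2 ^+ M)^-1 <= delta.
  have : 1 <= 2 ^+ M * delta.
    apply: le_trans K_ge _; rewrite ler_wpM2r ?(ltW delta_gt0) // -natrX ler_nat.
    by rewrite (leq_trans leK_M) // ltnW // ltn_expl.
  by rewrite -ler_pdivrMl ?exprn_gt0 // mulr1.
have {}h := le_trans h (ler_wpM2l (ler0n _ _) (lerD (lexx delta) pow)).
rewrite -(ler_pM2r gam4_gt0); move: h; rewrite /delta /bad_small.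
set a := #|_|%:R; set b := #|points|%:R; lra.
Qed.

(** There are at most [1 / (9 * gam ^+ 2)] relevant coefficients, each failing with probability at
    most [4 / (M * gam ^+ 2)]; with [M * gam ^+ 4 >= 24] the product is at most 1/54. *)
Lemma card_bad_coefs_le : #|bad_coefs|%:R * 54 <= #|points|%:R :> R.
Proof.
have M0 : (0 < M)%N by [].
have gam2 : 0 < gam ^+ 2 by rewrite exprn_gt0.
pose n9 := #|[set r | 9 * gam ^+ 2 <= spec r]|.
have n9_le : n9%:R * (9 * gam ^+ 2) <= 1.
  exact: (card_large sd (9 * gam ^+ 2) gJ g2).
have union : #|bad_coefs|%:R <= \sum_(r | 9 * gam ^+ 2 <= spec r) #|bad_coef L chi M gam g r|%:R :> R.
  by rewrite -natr_sum ler_nat card_bigcup_le.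
have each : #|bad_coefs|%:R * (M%:R * gam ^+ 2) <= n9%:R * (#|points|%:R * 4) :> R.
  apply: le_trans (ler_wpM2r _ union) _; first by rewrite mulr_ge0 ?ler0n ?ltW.
  rewrite mulr_suml [leRHS]mulr_natl -sumr_const.
  rewrite (eq_bigl (mem [set r | 9 * gam ^+ 2 <= spec r])) => [|r]; last by rewrite /= inE.
  apply: ler_sum => r _.
  have h := card_bad_coef sd gJ g2 r M0 gam_gt0. by [].
have step : #|bad_coefs|%:R * (M%:R * gam ^+ 2) * (9 * gam ^+ 2) <= #|points|%:R * 4 :> R.
  apply: le_trans (ler_wpM2r _ each) _; first by rewrite mulr_ge0 ?ltW.
  by rewrite mulrAC -[leRHS]mul1r ler_wpM2r ?mulr_ge0.
have := ler_wpM2l (ler0n R #|bad_coefs|) M_ge.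
rewrite (_ : _ * (M%:R * gam ^+ 4) = #|bad_coefs|%:R * (M%:R * gam ^+ 2) * gam ^+ 2); last first.
  by ring.
by move: step; rewrite mulrCA; lra.
Qed.

Lemma card_bad_points : #|bad_points|%:R * 6 <= #|points|%:R :> R.
Proof.
have := card_bad_types_le; rewrite -(ler_nat R) natrM => h1.
have h2 := card_bad_small_le; have h3 := card_bad_coefs_le.
have : #|bad_points|%:R <= #|bad_types sd M delta g|%:R + #|bad_small|%:R + #|bad_coefs|%:R :> R.
  rewrite -!natrD ler_nat; apply: leq_trans (leq_card_setU _ _) _.
  by rewrite leq_add2r leq_card_setU.
(* The total is 1/16 + 1/12 + 1/54, which is below 1/6. *)
have := ler0n R #|points|; lra.
Qed.

Lemma good_pointsP (x : {ffun D -> gT}) : x \in points -> x \notin bad_points ->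
  good_points chi gam delta g x.
Proof.
move=> xP; rewrite 2!finset.in_setU !negb_or => /andP[/andP[xT xS] xC]; split.
- by move=> e; move: xP; rewrite inE => /familyP/(_ e); rewrite inE => /eqP.
- exact: good_type xP xT.
- by rewrite leNgt; apply: contra xS => /ltW h; rewrite finset.in_set xP.
move=> r hr; rewrite leNgt; apply: contra xC => h.
have MR : 0 < M%:R :> R by rewrite ltr0n.
apply/bigcupP; exists r => //; rewrite finset.in_set xP /=.
apply: lerXn2r; first by rewrite nnegrE mulr_ge0 // ltW.
  by rewrite nnegrE cabs_ge0.
have -> : \sum_j deviation chi g r (x (ord0, j)) = M%:R%:C%C * (M%:R^-1 *
    (\sum_j g (x (ord0, j)) * (chi r (x (ord0, j)))^*%R) - hat chi g r).
  rewrite sumrB sumr_const card_ord -[hat _ _ _ *+ _]mulr_natl rmorph_nat mulrBr.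
  by rewrite mulVKf // pnatr_eq0.
by rewrite cabsM cabs_real ger0_norm ?ler0n // ler_pM2l // ltW.
Qed.

Lemma card_bad_shifts_le (x : {ffun D -> gT}) :
  #|bad_shifts chi S g x (gam ^+ 2)|%:R * 6 <= #|{: {ffun 'I_S -> gT * coefs}}|%:R :> R.
Proof.
have S0 : (0 < S)%N.
  rewrite lt0n; apply/eqP => S0; move: S_ge; rewrite S0 mul0r leNgt.
  by rewrite mulr_gt0 // ltr_wpDl ?ler0n.
have gam2 : 0 < gam ^+ 2 <= 1.
  by case/andP: gam01 => g0 g1; rewrite exprn_gt0 // exprn_ile1 // ltW.
have h := card_bad_shifts sd gJ g2 x S0 gam2.
apply: (@le_trans _ _ (((L ^ (L.+1 * M))%:R *
    (2 * expR (- (S%:R * (gam ^+ 2) ^+ 2 / 32))) * 6) * #|{: {ffun 'I_S -> gT * coefs}}|%:R)).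
  by rewrite [leRHS]mulrAC ler_wpM2r.
rewrite ler_piMl ?ler0n //.
have e1 : (L ^ (L.+1 * M))%:R <= expR (L * (L.+1 * M))%:R :> R.
  rewrite natrX natrM expRM_natr lerXn2r ?nnegrE ?expR_ge0 ?ler0n //.
  by apply: le_trans (expR_ge1Dx _); rewrite lerDr.
(* [S_ge] makes the tail beat the number of patterns, with [expR (- 12) <= 1 / 13] left to absorb
   the factor 2 * 6 = 12. *)
have e2 : expR (- (S%:R * (gam ^+ 2) ^+ 2 / 32)) <= (expR (L * (L.+1 * M))%:R)^-1 * 13^-1 :> R.
  have e13 : 13 <= expR 12 :> R.
    by apply: le_trans (expR_ge1Dx 12); rewrite -[1]/(1%:R) -natrD.
  apply: (@le_trans _ _ (expR (- (L * (L.+1 * M))%:R) * expR (- 12))).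
    by rewrite -expRD ler_expR -exprM; have := S_ge; lra.
  by rewrite !expRN ler_wpM2l ?invr_ge0 ?expR_ge0 // lef_pV2 ?posrE ?expR_gt0.
set E := expR (L * _)%:R in e1 e2; have E0 : 0 < E by apply: expR_gt0.
apply: (@le_trans _ _ (E * (2 * (E^-1 * 13^-1)) * 6)).
  rewrite ler_wpM2r //; apply: ler_pM; rewrite ?ler0n //; last by rewrite ler_wpM2l.
rewrite (_ : E * (2 * (E^-1 * 13^-1)) = 2 / 13 * (E / E)); last by ring.
by rewrite divff ?gt_eqF //; lra.
Qed.

End OneFunction.
Local Notation sample := ({ffun D -> gT} * {ffun 'I_S -> gT * coefs})%type.

(** The uniform law on torsion-respecting points and arbitrary shifts, extended by zero to the full
    function type used as seed. *)
Definition sample_weight (w : sample) : R :=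
  if w.1 \in points then (#|points|%:R * #|{: {ffun 'I_S -> gT * coefs}}|%:R)^-1 else 0.

Definition sample_queries (w : sample) : seq gT :=
  [seq w.1 (ord0, j) | j <- enum 'I_M] ++ [seq (w.2 j).1 | j <- fintype.enum 'I_S] ++
  [seq ((w.2 j).1 * subset_word w.1 (w.2 j).2)%g | j <- enum 'I_S].

Definition good_sample (B : {set gT}) (w : sample) : Prop :=
  good_points chi gam delta (sign_ind R B) w.1 /\
  good_shifts chi gam (sign_ind R B) w.1 w.2.

Lemma size_sample_queries w : size (sample_queries w) = (M + 2 * S)%N.
Proof. by rewrite /sample_queries !size_cat !size_map -!enumT !size_enum_ord mul2n addnn. Qed.

Lemma card_points_gt0 : 0 < #|points|%:R :> R.
Proof.
rewrite ltr0n; apply/card_gt0P; exists [ffun => 1%g].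
by rewrite inE; apply/familyP => e; rewrite ffunE inE expg1n.
Qed.

Lemma card_shifts_gt0 : 0 < #|{: {ffun 'I_S -> gT * coefs}}|%:R :> R.
Proof.
by rewrite ltr0n; apply/card_gt0P; exists [ffun => (1%g, [ffun => o0 sd])].
Qed.

Lemma sample_weight_ge0 w : 0 <= sample_weight w.
Proof.
by rewrite /sample_weight; case: ifP.
Qed.

Lemma sum_sample_weight (P : pred sample) :
  \sum_(w | P w) sample_weight w =
  (\sum_(x in points) #|[set v | P (x, v)]|%:R) /
    (#|points|%:R * #|{: {ffun 'I_S -> gT * coefs}}|%:R).
Proof.
transitivity (\sum_x \sum_v if P (x, v) then sample_weight (x, v) else 0).
  by rewrite pair_bigA big_mkcond; apply: eq_bigr => -[x v].
rewrite mulr_suml [RHS]big_mkcond; apply: eq_bigr => x _.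
rewrite -big_mkcond /= /sample_weight /=; case: ifP => xP; last by rewrite big1.
rewrite (eq_bigl (mem [set v | P (x, v)])) => [|v]; last by rewrite /= finset.in_set.
by rewrite sumr_const [RHS]mulr_natl.
Qed.

(** Points are good with probability at least 5/6, and given good points so are the shifts; 25/36
    exceeds 2/3. *)
Lemma good_sample_likely B : 2 / 3 <= \sum_(w | `[< good_sample B w >]) sample_weight w.
Proof.
set g := sign_ind R B; have gJ := @conj_sign_ind R gT B; have g2 := @sqr_sign_ind R gT B.
have N0 := card_points_gt0; have W0 := card_shifts_gt0.
set N : R := #|points|%:R in N0 *; set W : R := #|{: {ffun _ -> _}}|%:R in W0 *.
rewrite sum_sample_weight ler_pdivlMr ?mulr_gt0 //.
have good_x x : x \in points -> x \notin bad_points g ->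
    W * (5 / 6) <= #|[set v | `[< good_sample B (x, v) >]]|%:R.
  move=> xP xB; have := card_bad_shifts_le gJ g2 x.
  have : W <= #|bad_shifts chi S g x (gam ^+ 2)|%:R +
      #|[set v | `[< good_sample B (x, v) >]]|%:R.
    rewrite -natrD ler_nat; apply: leq_trans (leq_card_setU _ _).
    apply/subset_leq_card/fintype.subsetP => v _; rewrite finset.in_setU.
    have [//|vB] := boolP (v \in bad_shifts chi S g x (gam ^+ 2)).
    rewrite finset.in_set; apply/asboolP; split=> /=; first exact: good_pointsP.
    exact: good_shiftsP.
  rewrite -/W; lra.
apply: (@le_trans _ _ (\sum_(x in points :\: bad_points g) W * (5 / 6))).
  rewrite sumr_const -[_ *+ _]mulr_natl.
  have : N <= #|points :\: bad_points g|%:R + #|bad_points g|%:R.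
    rewrite -natrD ler_nat -(cardsID (bad_points g) points) addnC leq_add2l.
    exact/subset_leq_card/finset.subsetIr.
  have := card_bad_points gJ g2; rewrite -/N; set a := #|_ :\: _|%:R; set b := #|_|%:R => h1 h2.
  have : N * (5 / 6) <= a by lra.
  by move=> /(ler_wpM2r (ltW W0)); nra.
rewrite [leRHS](bigID (mem (bad_points g))) /=; apply: ler_wpDl.
  by apply: sumr_ge0 => x _; apply: ler0n.
rewrite (eq_bigl (fun x => (x \in points) && (x \notin bad_points g))) => [|x].
  by apply: ler_sum => x /andP[]; apply: good_x.
by rewrite finset.in_setD andbC.
Qed.

Lemma solvable_with_samples (A : {set gT}) (eps tau s : R) :
  \sum_r cabs (hat chi (sign_ind R A) r) <= s -> 5 * gam * s < tau ->
  solvable_with A eps tau (M + 2 * S).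
Proof.
move=> normA gs; have g0 := gam_gt0.
apply: (solvable_by_sampling (p := sample_weight) (pts := sample_queries)
  (good := good_sample)).
- exact: sample_weight_ge0.
- rewrite (sum_sample_weight predT).
  have -> : \sum_(x in points) #|[set v : {ffun 'I_S -> gT * coefs} | predT (x, v)]|%:R =
      #|points|%:R * #|{: {ffun 'I_S -> gT * coefs}}|%:R :> R.
    rewrite (eq_bigr (fun=> #|{: {ffun 'I_S -> gT * coefs}}|%:R : R)) => [|x _]; last by rewrite cardsE.
    by rewrite sumr_const [RHS]mulr_natl.
  by rewrite divff // gt_eqF // mulr_gt0 ?card_points_gt0 ?card_shifts_gt0.
- by move=> w; rewrite size_sample_queries.
- exact: good_sample_likely.
move=> B B' [x w] [gx gw] [gx' gw'] /= /eqP.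
rewrite /sample_queries !map_cat !eqseq_cat ?size_map // -!map_comp.
case/and3P=> /eqP/eq_in_map e1 /eqP/eq_in_map e2 /eqP/eq_in_map e3.
have all_ord k (j : 'I_k) : j \in Finite.enum 'I_k by rewrite -enumT mem_enum.
have ag : agree (sign_ind R B) (sign_ind R B') x w.
  split=> j; rewrite /sign_ind.
  - by have /= -> := e1 j (all_ord _ j).
  - by have /= -> := e2 j (all_ord _ j).
  by have /= -> := e3 j (all_ord _ j).
have dle : delta <= 9 * gam ^+ 2.
  rewrite /delta; case/andP: gam01 => _ g1.
  have : gam ^+ 4 <= gam ^+ 2 by rewrite ler_wiXn2l // ltW.
  have : 0 <= gam ^+ 2 by apply: sqr_ge0.
  lra.
have [s0 s0A close] := close_up_to_aut sd g0 dle gx gx' gw gw' ag.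
move=> /dist_Aut_attained[t tA dt].
have le := dist_transfer sd A tA s0A (ltW g0) close.
have dA := dist_Aut_le R A B (groupM s0A tA).
apply: le_lt_trans (le_trans dA le) _.
apply: ler_ltD => //; apply: le_lt_trans gs; by rewrite ler_wpM2l // mulr_ge0 // ltW.
Qed.

End Tester.

(** * The explicit characters of a product of cyclic groups *)

Section ExplicitCharacters.
Variables (R : realType) (n : nat) (p m : 'I_n -> nat) (gT : finGroupType).
Variables (phi : {morphism [set: gT] >-> prod_cyclic p m}) (omega : nat -> R[i]).
Hypothesis p_prime : forall i, prime (p i).
Hypothesis m_gt0 : forall i, (0 < m i)%N.
Hypothesis cG : abelian [set: gT].
Hypothesis isom_phi : isom [set: gT] [set: prod_cyclic p m] phi.
Hypothesis omega_prim : forall i, (p i ^ m i).-primitive_root (omega (p i ^ m i)%N).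

Let q i := (p i ^ m i)%N.
Let L := (\big[lcmn/1%N]_(i < n) q i)%N.

Lemma q_gt1 i : (1 < q i)%N.
Proof. by rewrite -(exp1n (m i)) ltn_exp2r // prime_gt1. Qed.

Lemma dvd_q_L i : (q i %| L)%N.
Proof. exact: biglcmn_sup. Qed.

Lemma L_gt0 : (0 < L)%N.
Proof.
rewrite /L; elim/big_ind: _ => // [a b a0 b0|i _]; first by rewrite lcmn_gt0 a0.
exact: ltnW (q_gt1 i).
Qed.

Lemma phiM x y i : phi (x * y)%g i = phi x i + phi y i.
Proof. by rewrite morphM ?inE // ffunE. Qed.

Lemma phi_inj : injective phi.
Proof. by case/isomP: isom_phi => /injmP h _ x y; apply: h; rewrite inE. Qed.

Lemma phi_surj v : exists x, phi x = v.
Proof.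
case/isomP: isom_phi => _ im.
have : v \in (phi @* [set: gT])%g by rewrite im inE.
by case/morphimP => x _ _ ->; exists x.
Qed.

Lemma explicit_self_dual : self_dual L (chi phi omega).
Proof.
have phiX x k i : phi (x ^+ k)%g i = phi x i *+ k.
  elim: k => [|k IH]; first by rewrite expg0 morph1 mulr0n ffunE.
  by rewrite expgS phiM IH mulrS.
have omega_q i : omega (q i) ^+ q i = 1 by apply: prim_expr_order (omega_prim i).
have exp_add i (a b : 'Z_(q i)) (z : R[i]) :
    z ^+ q i = 1 -> z ^+ (a + b)%R = z ^+ a * z ^+ b.
  move=> zq; rewrite -exprD -(expr_mod (a + b)%N zq) /=.
  by rewrite [X in (_ %% X)%N]Zp_cast ?q_gt1.
split=> //.
- exact: L_gt0.
- move=> x; apply: phi_inj; apply/ffunP => i; rewrite phiX morph1 ffunE.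
  have /dvdnP[c ->] := dvd_q_L i.
  rewrite mulnC mulrnA -[X in X *+ c](_ : 0 = _) ?mul0rn //.
  by rewrite -mulr_natr (pchar_Zp (q_gt1 i)) mulr0.
- move=> r x y; rewrite /chi -big_split; apply: eq_bigr => i _ /=.
  by rewrite phiM exprM exp_add -?exprM // mulnC exprM (omega_q i) expr1n.
- by move=> r x; apply: eq_bigr => i _; rewrite mulnC.
- move=> r x; rewrite /chi -prodrXl big1 // => i _.
  have /dvdnP[c ->] := dvd_q_L i.
  by rewrite exprAC [(c * _)%N]mulnC [X in X ^+ _]exprM (omega_q i) !expr1n.
move=> x h; apply: phi_inj; apply/ffunP => i; rewrite morph1 ffunE.
(* Testing against the [i]-th unit vector isolates the [i]-th coordinate: [omega] to that power is
   1, and primitivity forces the coordinate to vanish. *)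
pose v : prod_cyclic p m := [ffun j => if j == i then 1 else 0].
have [r rv] := phi_surj v.
have := h r; rewrite /chi (bigD1 i) //= big1 => [|j /negPf ji]; last first.
  by rewrite rv ffunE ji mul0n expr0.
rewrite rv ffunE eqxx mulr1 => /eqP.
rewrite -(prim_order_dvd (omega_prim i)) mul1n => dvd.
apply/val_inj/eqP; rewrite /= -[_ == _]negbK -lt0n; apply/negP => a0.
have := dvdn_leq a0 dvd; rewrite leqNgt => /negP; apply.
by rewrite -[X in (_ < X)%N](Zp_cast (q_gt1 i)) ltn_ord.
Qed.
End ExplicitCharacters.

(** With [u = gam ^- 4], [K] and the number of points are [O(u)] and [S] is [O(u ^+ 2)], with
    constants depending on [L] only. *)
Lemma sample_sizes (R : realType) (L : nat) :
  exists2 C : R, 0 < C & forall gam : R, 0 < gam <= 1 -> exists K S : nat,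
    [/\ 1 <= K%:R * (gam ^+ 4 / 24),
        32 * ((L * (L.+1 * (5 + L + L * K)))%:R + 12) <= S%:R * gam ^+ 4
      & ((5 + L + L * K) + 2 * S)%:R <= C / gam ^+ 8].
Proof.
(* As [u >= 1], [K <= 25 * u] gives at most [c1 * u] points; the final 1 in [c2] absorbs the
   rounding of [S]. *)
pose c1 : R := (5 + 26 * L)%:R; pose c2 : R := 32 * ((L * L.+1)%:R * c1 + 12) + 1.
have c1_ge0 : 0 <= c1 by apply: ler0n.
have c2_gt0 : 0 < c2 by rewrite ltr_wpDl // mulr_ge0 // addr_ge0 // mulr_ge0 ?ler0n.
exists (c1 + 2 * c2) => [|gam /andP[g0 g1]]; first by rewrite ltr_wpDl // mulr_gt0.
have g4 : 0 < gam ^+ 4 by rewrite exprn_gt0.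
pose u := (gam ^+ 4)^-1.
have u1 : 1 <= u by rewrite invf_ge1 // exprn_ile1 // ltW.
have u0 : 0 < u by rewrite invr_gt0.
have ug : u * gam ^+ 4 = 1 by rewrite mulVf // gt_eqF.
have ceil (t : R) : 0 <= t -> exists2 N : nat, t <= N%:R & N%:R <= t + 1.
  move=> t0; have /andP[h1 h2] := truncn_itv t0.
  by exists (Num.truncn t).+1; [exact: ltW | rewrite -natr1 lerD2r].
have [K K1 K2] : exists2 N : nat, 24 * u <= N%:R & N%:R <= 24 * u + 1.
  by apply: ceil; rewrite mulr_ge0 // ltW.
have [S S1 S2] : exists2 N : nat, 32 * ((L * (L.+1 * (5 + L + L * K)))%:R + 12) * u <= N%:R &
    N%:R <= 32 * ((L * (L.+1 * (5 + L + L * K)))%:R + 12) * u + 1.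
  by apply: ceil; rewrite mulr_ge0 ?(ltW u0) // mulr_ge0 // addr_ge0 ?ler0n.
exists K, S; split.
- have : 24 * (u * gam ^+ 4) <= K%:R * gam ^+ 4 by rewrite mulrA ler_wpM2r // ltW.
  by rewrite ug; lra.
- by rewrite -[leLHS]mulr1 -[X in _ * X <= _]ug mulrA ler_wpM2r // ltW.
have M_le : (5 + L + L * K)%:R <= c1 * u.
  rewrite /c1 !natrD !natrM.
  have L0 : 0 <= L%:R :> R by apply: ler0n.
  have : L%:R * K%:R <= L%:R * (25 * u) by rewrite ler_wpM2l //; lra.
  have : L%:R <= L%:R * u by rewrite ler_peMr.
  lra.
have S_le : S%:R <= c2 * u ^+ 2.
  have : (L * (L.+1 * (5 + L + L * K)))%:R <= (L * L.+1)%:R * c1 * u.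
    by rewrite mulnA natrM -mulrA ler_wpM2l.
  move=> /(ler_wpM2r (ltW u0)) h.
  have u2 : u <= u ^+ 2 by rewrite expr2 ler_peMr // ltW.
  move: S2 h; rewrite /c2; set a := (L * _)%:R; set b := (L * _)%:R * c1 => S2 h.
  apply: le_trans S2 _; have : u * u = u ^+ 2 by [].
  rewrite -[b * u * u]mulrA in h; move=> uu; rewrite uu in h.
  by lra.
rewrite natrD natrM (_ : _ / gam ^+ 8 = (c1 + 2 * c2) * u ^+ 2); last first.
  by rewrite /u exprVn -exprM.
have : c1 * u <= c1 * u ^+ 2 by rewrite ler_wpM2l // expr2 ler_peMr // ltW.
lra.
Qed.

Theorem theorem3 (R : realType) (L : nat) :
  exists (C : R) (k : nat), 0 < C /\
    forall (n : nat) (p m : 'I_n -> nat),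
      (forall i, prime (p i)) ->
      (forall i, (0 < m i)%N) ->
      (\big[lcmn/1%N]_(i < n) (p i ^ m i)%N)%N = L ->
    forall (gT : finGroupType) (phi : {morphism [set: gT] >-> prod_cyclic p m}),
      abelian [set: gT] ->
      isom [set: gT] [set: prod_cyclic p m] phi ->
    forall omega : nat -> R[i],
      (forall i, (p i ^ m i).-primitive_root (omega (p i ^ m i)%N)) ->
    forall eps tau : R,
      0 < eps <= 1 / 2 ->
      0 < tau <= 1 / 2 ->
    forall (A : {set gT}) (s : R),
      fourier_norm1 phi omega (sign_ind R A) <= s ->
    exists q : nat,
      is_query_complexity A eps tau q /\
      q%:R <= C * (s ^+ 8 / tau ^+ 8) * (1 + ln s) ^+ k * (1 + ln (1 / tau)) ^+ k.
Proof.
have [C C0 sizes] := sample_sizes R L.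
(* The factor [6 ^+ 8] comes from [gam = tau / (6 * s)]; no logarithms are lost, hence exponent
   0. *)
exists (C * 6 ^+ 8), 0%N; split; first by rewrite mulr_gt0 // exprn_gt0.
move=> n p m p_prime m_gt0 defL gT phi cG isom_phi omega omega_prim eps tau _.
case/andP=> tau0 tau1 A s normA.
have sd := explicit_self_dual p_prime m_gt0 cG isom_phi omega_prim.
rewrite defL in sd.
(* Fourier inversion at the identity bounds the modulus 1 of the sign by the spectral norm; this
   yields [gam <= 1]. *)
have s1 : 1 <= s.
  apply: le_trans normA; rewrite -(cabs1 R) -(cabsN 1).
  have -> : cabs (- 1) = cabs (sign_ind R A 1%g).
    by rewrite /sign_ind; case: ifP; rewrite ?cabsN.
  rewrite (fourier_inv sd (sign_ind R A) 1%g).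
  apply: le_trans (cabs_sum _ _) _; apply: ler_sum => r _.
  by rewrite cabsM (cabs_chi sd) mulr1.
have s0 : 0 < s by apply: lt_le_trans s1.
pose gam := tau / (6 * s).
have gam01 : 0 < gam <= 1.
  rewrite divr_gt0 ?mulr_gt0 //= ler_pdivrMr ?mulr_gt0 // mul1r; lra.
have [K [S [K_ge S_ge Q_le]]] := sizes gam gam01.
have gs : 5 * gam * s < tau.
  rewrite (_ : 5 * gam * s = 5 / 6 * tau); first lra.
  by rewrite /gam; field; rewrite gt_eqF.
have sol := solvable_with_samples sd gam01 K_ge S_ge eps normA gs.
have ex : exists N, `[< solvable_with A eps tau N >].
  by exists (5 + L + L * K + 2 * S)%N; apply/asboolP.
case: (ex_minnP ex) => q /asboolP solq minq.
exists q; split; first by split=> // q' solq'; apply: minq; apply/asboolP.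
rewrite !expr0 !mulr1; apply: (@le_trans _ _ (5 + L + L * K + 2 * S)%:R).
  by rewrite ler_nat minq //; apply/asboolP.
apply: le_trans Q_le _; rewrite le_eqVlt; apply/orP; left; apply/eqP.
by rewrite /gam; field; rewrite !gt_eqF.
Qed.
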